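(* Let $d$ be an odd prime, $n\ge1$, and let $G$ be a positive convolution matrix over $\mathbb Z_d$ (invertible with all four entries nonzero). If the $n$-qudit state $\sigma$ is diagonal in the stabilizer basis for a maximal isotropic subspace $\mathcal M_0\subseteq V^n$, namely $\sigma=\sum_{\mu\in\widehat{\mathcal M_0}}\lambda_\mu P_\mu^{(\mathcal M_0)}$, then $$C_H(\Lambda_\sigma)=\chi(\Lambda_\sigma)=n\log d-S(\sigma)=n\log d-\min_{\mathcal M}S(\Delta_{\mathcal M}(\sigma)),$$ where the minimum is over all maximal isotropic subspaces $\mathcal M\subseteq V^n$.
   Context: All logarithms are base two. $S(\rho)=-\operatorname{tr}\rho\log\rho$ is the von Neumann entropy. Weyl operators. $d$ is an odd prime, $\omega_d=e^{2\pi i/d}$. On one qudit $X|k\rangle=|k+1\rangle$, $Z|k\rangle=\omega_d^k|k\rangle$ (arithmetic mod $d$). $V^n=\mathbb Z_d^n\times\mathbb Z_d^n$; for $p,q\in\mathbb Z_d^n$, $Z^p=\bigotimes_i Z^{p_i}$, $X^q=\bigotimes_i X^{q_i}$, and $w(p,q)=\omega_d^{-2^{-1}p\cdot q}Z^pX^q$ on $(\mathbb C^d)^{\otimes n}$, where $2^{-1}$ is the inverse of $2$ in $\mathbb Z_d$. Symplectic form: $\langle(p,q),(p',q')\rangle_s=p\cdot q'-p'\cdot q$. A linear subspace $N\subseteq V^n$ is isotropic if $\langle u,v\rangle_s=0$ for all $u,v\in N$; it is maximal isotropic iff moreover $\dim N=n$. For maximal isotropic $\mathcal M$, $\widehat{\mathcal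 M}=\operatorname{Hom}(\mathcal M,U(1))$ and $P_\mu^{(\mathcal M)}=d^{-n}\sum_{u\in\mathcal M}\mu(u)w(u)$, $\mu\in\widehat{\mathcal M}$, are mutually orthogonal rank-one projectors summing to the identity. The stabilizer pinching is $\Delta_{\mathcal M}(\rho)=\sum_{\mu}P^{(\mathcal M)}_\mu\rho P^{(\mathcal M)}_\mu=d^{-n}\sum_{u\in\mathcal M}w(u)\rho w(u)^\dagger$. Convolutional channel. $G=\begin{pmatrix} g_{00} & g_{01} \\ g_{10} & g_{11} \end{pmatrix}$ is invertible over $\mathbb Z_d$, $N_G=(\det G)^{-1}\in\mathbb Z_d$, and $U_G$ is the unitary on $\mathcal H_A\otimes\mathcal H_B$, $\mathcal H_A=\mathcal H_B=(\mathbb C^d)^{\otimes n}$, with $U_G|i,j\rangle=|N_Gg_{11}i-N_Gg_{10}j,\,-N_Gg_{01}i+N_Gg_{00}j\rangle$ for $i,j\in\mathbb Z_d^n$. For a state $\sigma$ on $\mathcal H_B$, $\Lambda_\sigma(\rho)=\operatorname{tr}_B[U_G(\rho\otimes\sigma)U_G^\dagger]$. The one-shot Holevo information of a channel $\Lambda$ is $\chi(\Lambda)=\max_{\{p_i,\rho_i\}}\big[S(\Lambda(\sum_ip_i\rho_i))-\sum_ip_iS(\Lambda(\rho_i))\big]$, over finite ensembles of input states, and the regularized Holevo capacity is $C_H(\Lambda)=\lim_{m\to\infty}\frac1m\chi(\Lambda^{\otimes m})$. *)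

(* Defs.v *)
(* Operators on the Hilbert space with orthonormal basis |i>, i in a finite type I, are the square matrices of
   size #|I| over R[i], R : realType. *)
From HB Require Import structures.
From mathcomp Require Import all_boot all_order all_algebra all_field.
From mathcomp Require Import all_classical all_reals all_analysis.
From mathcomp Require Import complex.

Set Implicit Arguments.
Unset Strict Implicit.
Unset Printing Implicit Defensive.

Import Order.TTheory GRing.Theory Num.Theory.
Import numFieldNormedType.Exports.

Local Open Scope classical_set_scope.
Local Open Scope complex_scope.
Local Open Scope sesquilinear_scope.
Local Open Scope ring_scope.

Notation op R I := 'M[R[i]]_(#|{: I}|).

Section Operators.
Variable R : realType.

Definition entry (I : finType) (A : op R I) (i j : I) : R[i] :=
  A (enum_rank i) (enum_rank j).

Definition mkop (I : finType) (f : I -> I -> R[i]) : op R I :=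
  \matrix_(a, b) f (enum_val a) (enum_val b).

(* |i><j| *)
Definition ketbra (I : finType) (i j : I) : op R I :=
  mkop (fun a b => ((a == i) && (b == j))%:R).

Definition tensor2 (I J : finType) (A : op R I) (B : op R J) :
    op R (I * J)%type :=
  mkop (fun x y => entry A x.1 y.1 * entry B x.2 y.2).

(* A_0 (x) ... (x) A_(m-1); the basis of the m-fold tensor power is indexed by
   the row vectors of length m with entries in I *)
Definition tensor_family (I : finType) (m : nat) (A : 'I_m -> op R I) :
    op R 'rV[I]_m :=
  mkop (fun x y : 'rV[I]_m => \prod_(k < m) entry (A k) (x ord0 k) (y ord0 k)).

Definition partial_trace2 (I J : finType) (A : op R (I * J)%type) : op R I :=
  mkop (fun a b => \sum_(j : J) entry A (a, j) (b, j)).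

(* positivity in R[i] entails realness, so rho is in particular Hermitian *)
Definition density (I : finType) (rho : op R I) : Prop :=
  (forall v : 'rV[R[i]]_(#|{: I}|), 0 <= (v *m rho *m v^t*) ord0 ord0) /\
  \tr rho = 1.

Definition log2 (x : R) : R := ln x / ln 2.

(* Logarithm of a positive semidefinite operator by spectral calculus.
   Since ln 0 = 0, null eigenvalues contribute 0 log 0 = 0 to the entropy. *)
Definition oplog (I : finType) (A : op R I) : op R I :=
  invmx (spectralmx A)
  *m diag_mx (map_mx (fun z => (log2 (complex.Re z))%:C) (spectral_diag A))
  *m spectralmx A.

Definition entropy (I : finType) (rho : op R I) : R :=
  - complex.Re (\tr (rho *m oplog rho)).

(* The linear extension of A_0 (x) ... (x) A_(m-1) |->
   L A_0 (x) ... (x) L A_(m-1), for L linear. *)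
Definition channel_power (I J : finType) (L : op R I -> op R J) (m : nat)
    (rho : op R 'rV[I]_m) : op R 'rV[J]_m :=
  \sum_(x : 'rV[I]_m) \sum_(y : 'rV[I]_m)
    entry rho x y *: tensor_family (fun k => L (ketbra (x ord0 k) (y ord0 k))).

Definition holevo_values (I J : finType) (L : op R I -> op R J) : set R :=
  [set x | exists (k : nat) (p : 'I_k -> R) (rho : 'I_k -> op R I),
    [/\ forall i, 0 <= p i, \sum_i p i = 1, forall i, density (rho i) &
        x = entropy (L (\sum_i (p i)%:C *: rho i))
            - \sum_i p i * entropy (L (rho i))]].

Definition holevo_info (I J : finType) (L : op R I -> op R J) : R :=
  sup (holevo_values L).

Definition holevo_rate (I J : finType) (L : op R I -> op R J) : R^nat :=
  fun m => m%:R^-1 * holevo_info (@channel_power I J L m).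

Definition holevo_capacity (I J : finType) (L : op R I -> op R J) : R :=
  limn (holevo_rate L).

Definition has_max (A : set R) : Prop := exists2 x, A x & ubound A x.
Definition has_min (A : set R) : Prop := exists2 x, A x & lbound A x.

End Operators.

(* 'F_d is Z/dZ for d prime, the only case of interest. *)
Section Weyl.
Variables (R : realType) (d n : nat).

Definition omega : R[i] := cos (2 * pi / d%:R) +i* sin (2 * pi / d%:R).

(* omega ^ k for k in Z/dZ, through the representative 0 <= k < d *)
Definition omega_pow (k : 'F_d) : R[i] := omega ^+ (k : nat).

Definition shiftX : op R 'F_d := mkop (fun a b : 'F_d => (a == b + 1)%:R).
Definition clockZ : op R 'F_d :=
  mkop (fun a b : 'F_d => (a == b)%:R * omega_pow b).

Definition weylX (q : 'rV['F_d]_n) : op R 'rV['F_d]_n :=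
  tensor_family (fun k => shiftX ^+ (q ord0 k : nat)).
Definition weylZ (p : 'rV['F_d]_n) : op R 'rV['F_d]_n :=
  tensor_family (fun k => clockZ ^+ (p ord0 k : nat)).

Definition dot (p q : 'rV['F_d]_n) : 'F_d := \sum_(k < n) p ord0 k * q ord0 k.

Definition phase_space : vectType 'F_d :=
  ('rV['F_d]_n * 'rV['F_d]_n)%type.

Definition weyl (u : 'rV['F_d]_n * 'rV['F_d]_n) : op R 'rV['F_d]_n :=
  omega_pow (- (2%:R^-1 * dot u.1 u.2)) *: (weylZ u.1 *m weylX u.2).

Definition symp (u v : 'rV['F_d]_n * 'rV['F_d]_n) : 'F_d :=
  dot u.1 v.2 - dot v.1 u.2.

Definition isotropic (N : {vspace phase_space}) : Prop :=
  forall u v : phase_space, u \in N -> v \in N -> symp u v = 0.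

Definition max_isotropic (N : {vspace phase_space}) : Prop :=
  isotropic N /\ \dim N = n.

(* Hom(M, U(1)); it is finite (d ^ dim M elements for d prime), so that the
   finitely supported sums over it below are genuine sums *)
Definition dual (M : {vspace phase_space}) : set (subvs_of M -> R[i]) :=
  [set mu | (forall u, `|mu u| = 1) /\
            (forall u v, mu (u + v) = mu u * mu v)].
Arguments dual M : clear implicits.

Definition stab_proj (M : {vspace phase_space}) (mu : subvs_of M -> R[i]) :
    op R 'rV['F_d]_n :=
  (d%:R ^+ n)^-1 *:
    \sum_(u : 'rV['F_d]_n * 'rV['F_d]_n | (u : phase_space) \in M)
      mu (vsproj M u) *: weyl u.

Definition pinching (M : {vspace phase_space}) (rho : op R 'rV['F_d]_n) :
    op R 'rV['F_d]_n :=
  \sum_(mu \in dual M) stab_proj mu *m rho *m stab_proj mu.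

Definition pinched_entropies (rho : op R 'rV['F_d]_n) : set R :=
  [set entropy (pinching M rho) | M in [set M | max_isotropic M]].

Definition positive_convolution (G : 'M['F_d]_2) : Prop :=
  G \in unitmx /\ forall a b, G a b != 0.

Definition conv_map (G : 'M['F_d]_2) (x : 'rV['F_d]_n * 'rV['F_d]_n) :
    'rV['F_d]_n * 'rV['F_d]_n :=
  let N := (\det G)^-1 in
  ((N * G 1 1) *: x.1 - (N * G 1 0) *: x.2,
   - (N * G 0 1) *: x.1 + (N * G 0 0) *: x.2).

Definition conv_unitary (G : 'M['F_d]_2) :
    op R ('rV['F_d]_n * 'rV['F_d]_n)%type :=
  mkop (fun x y => (x == conv_map G y)%:R).

Definition conv_channel (G : 'M['F_d]_2) (sigma rho : op R 'rV['F_d]_n) :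
    op R 'rV['F_d]_n :=
  partial_trace2
    (conv_unitary G *m tensor2 rho sigma *m (conv_unitary G)^t*).

End Weyl.

Arguments dual R {d n} M.

(* Main.v *)
(* Writing g_ab for the entries of G, the channel acts on matrix entries by
     Lambda_sigma(rho)[a, b] =
       sum_j rho[g00 a + g10 j, g00 b + g10 j] * sigma[g01 a + g11 j, g01 b + g11 j].
   For a fixed state rho, the map sigma |-> Lambda_sigma(rho) is positive, trace
   preserving and, since no entry of G vanishes, unital; such maps do not decrease
   entropy, because they act on spectra by doubly stochastic matrices. Hence every
   output of Lambda_sigma has entropy at least S(sigma), and chi <= n log d - S(sigma).
   The m-th tensor power is a channel of the same form with the m-th tensor power of
   sigma in place of sigma, so the same bound holds up to a factor m.
   For equality, parametrize M0 by a linear isotropic embedding beta of F_d^n and let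
   P_k(beta) be the stabilizer projectors. There are linear maps A, B of phase space,
   scaling the symplectic form, such that
     Lambda_(w(B y))(w(A z)) = d^n [y = z] w(z).
   With beta' = B^-1 o beta this gives
     Lambda_(P_j(beta))(P_k(A o beta')) = P_(j+k)(beta'),
   so every input P_k(A o beta') is sent to a state with the spectrum of sigma, and the
   uniform mixture of these inputs is sent to the maximally mixed state.
   Pinchings are unital channels too, and the pinching by M0 fixes sigma. *)
Require Import Defs.
From HB Require Import structures.
From mathcomp Require Import all_boot all_order all_algebra all_field.
From mathcomp Require Import all_classical all_reals all_analysis.
From mathcomp Require Import complex.
From mathcomp Require Import ring.

Set Implicit Arguments.
Unset Strict Implicit.
Unset Printing Implicit Defensive.

Import Order.TTheory GRing.Theory Num.Theory.
Import numFieldNormedType.Exports.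

Local Open Scope classical_set_scope.
Local Open Scope sesquilinear_scope.
Local Open Scope ring_scope.

(** * Operators and entropy *)

Section UnitaryDiag.
Variable C : numClosedFieldType.

(** The difference [A - A^t*] is skew-Hermitian, hence normal, and its eigenvalues are values of its
    quadratic form on the rows of a unitary. These vanish because the form of [A] is real. *)
Lemma real_form_hermsym (n : nat) (A : 'M[C]_n) :
  (forall v : 'rV_n, (v *m A *m v^t*) 0 0 \is Num.real) -> A^t* = A.
Proof.
move=> Areal; pose K := A - A^t*.
have KN : K^t* = - K.
  by rewrite /K; apply/matrixP => i j; rewrite !mxE rmorphB /= conjCK opprB.
have K0 (v : 'rV_n) : (v *m K *m v^t*) 0 0 = 0.
  rewrite /K mulmxBr mulmxBl mxE [X in _ + X]mxE.
  set z := (v *m A *m _) 0 0.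
  suff -> : (v *m A^t* *m v^t*) 0 0 = z^* by rewrite (CrealP (Areal v)) subrr.
  have -> : v *m A^t* *m v^t* = (v *m A *m v^t*)^t*.
    by rewrite !trmx_mul !map_mxM /= trmxCK mulmxA.
  by rewrite [LHS]mxE [X in Num.conj X]mxE.
have /orthomx_spectralP KE : K \is normalmx.
  by apply/normalmxP; rewrite KN mulmxN mulNmx.
suff D0 : diag_mx (spectral_diag K) = 0.
  by move: KE; rewrite D0 mulmx0 mul0mx => /eqP; rewrite subr_eq0 => /eqP <-.
have Pu := spectral_unitarymx K.
have DE : diag_mx (spectral_diag K) = spectralmx K *m K *m (spectralmx K)^t*.
  by rewrite {3}KE -invmx_unitary // !mulmxA mulmxV ?spectral_unit // mul1mx mulmxK ?spectral_unit.
apply/matrixP => i j; rewrite [RHS]mxE; have [<-|ij] := eqVneq i j; last first.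
  by rewrite mxE (negPf ij).
rewrite DE -(K0 (row i (spectralmx K))) -row_mul !mxE.
by apply: eq_bigr => k _; rewrite !mxE.
Qed.

Lemma adj_normal (n : nat) (A : 'M[C]_n) : A^t* = A -> A \is normalmx.
Proof. by move=> AA; apply/normalmxP; rewrite AA. Qed.

(** A nonzero entry [W i j] forces the [j]-th entry of [a] to equal the [i]-th entry of [b], so [g]
    agrees on them. *)
Lemma intertwine_map_diag (n : nat) (g : C -> C) (W : 'M[C]_n) (a b : 'rV_n) :
  W *m diag_mx a = diag_mx b *m W ->
  W *m diag_mx (map_mx g a) = diag_mx (map_mx g b) *m W.
Proof.
move=> Wab; apply/matrixP => i j; have /matrixP /(_ i j) := Wab.
rewrite !mul_mx_diag !mul_diag_mx !mxE => H.
have [-> |W0] := eqVneq (W i j) 0; first by rewrite mulr0 mul0r.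
by move: H; rewrite mulrC => /(mulIf W0) ->; apply: mulrC.
Qed.

(** [P *m E^t*] intertwines the two diagonal matrices, hence also their images under [g]. This frees
    [oplog] from the particular choice of [spectralmx]. *)
Lemma unitary_calculus (n : nat) (g : C -> C) (P E : 'M[C]_n) (a b : 'rV_n) :
  P \in unitmx -> E \is unitarymx ->
  E^t* *m diag_mx a *m E = invmx P *m diag_mx b *m P ->
  invmx P *m diag_mx (map_mx g b) *m P = E^t* *m diag_mx (map_mx g a) *m E.
Proof.
move=> Pu Eu ab; have EtE : E^t* *m E = 1%:M by apply/mulmx1C/unitarymxP.
have W : P *m E^t* *m diag_mx a = diag_mx b *m (P *m E^t*).
  have := congr1 (fun A => P *m A *m E^t*) ab.
  by rewrite !mulmxA mulmxV // mul1mx mulmxtVK.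
have {}W := congr1 (fun A => invmx P *m A *m E) (intertwine_map_diag g W).
rewrite !mulmxA mulVmx // mul1mx in W; rewrite W.
by rewrite -[RHS]mulmxA EtE mulmx1.
Qed.

Lemma trace_unitary_mul (n : nat) (E A B : 'M[C]_n) : E \is unitarymx ->
  \tr (E^t* *m A *m E *m (E^t* *m B *m E)) = \tr (A *m B).
Proof.
move=> Eu; have -> : E^t* *m A *m E *m (E^t* *m B *m E) = E^t* *m (A *m B *m E).
  by rewrite !mulmxA mulmxtVK.
by rewrite mxtrace_mulC mulmxtVK.
Qed.

Lemma adj_unitary_diag (n : nat) (E : 'M[C]_n) (a : 'rV_n) :
  (forall k, (a ord0 k)^* = a ord0 k) ->
  (E^t* *m diag_mx a *m E)^t* = E^t* *m diag_mx a *m E.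
Proof.
move=> a_real; rewrite !trmx_mul !map_mxM /= trmxCK mulmxA tr_diag_mx map_diag_mx.
by congr (_ *m diag_mx _ *m _); apply/rowP => k; rewrite mxE; apply: a_real.
Qed.

End UnitaryDiag.

Section Entries.
Variable R : realType.
Local Notation C := R[i].

Lemma entry_mkop (I : finType) (f : I -> I -> C) i j : entry (mkop f) i j = f i j.
Proof. by rewrite /entry mxE !enum_rankK. Qed.

Lemma eq_op (I : finType) (A B : op R I) :
  (forall i j, entry A i j = entry B i j) -> A = B.
Proof.
move=> AB; apply/matrixP => a b.
by have := AB (enum_val a) (enum_val b); rewrite /entry !enum_valK.
Qed.

Lemma entry_mul (I : finType) (A B : op R I) i j :
  entry (A *m B) i j = \sum_k entry A i k * entry B k j.
Proof.
rewrite /entry mxE (reindex (@enum_rank I)) //=.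
by apply: onW_bij; apply: enum_rank_bij.
Qed.

Lemma entry_sum (I : finType) (K : Type) (r : seq K) (P : pred K)
    (A : K -> op R I) i j :
  entry (\sum_(k <- r | P k) A k) i j = \sum_(k <- r | P k) entry (A k) i j.
Proof. by rewrite /entry summxE. Qed.

Lemma entryZ (I : finType) z (A : op R I) i j : entry (z *: A) i j = z * entry A i j.
Proof. by rewrite /entry mxE. Qed.

Lemma entry1 (I : finType) i j : entry (1%:M : op R I) i j = (i == j)%:R.
Proof. by rewrite /entry mxE (inj_eq enum_rank_inj). Qed.

Lemma trace_entry (I : finType) (A : op R I) : \tr A = \sum_i entry A i i.
Proof.
rewrite /mxtrace (reindex (@enum_rank I)) //=.
by apply: onW_bij; apply: enum_rank_bij.
Qed.

Lemma entry_adj (I : finType) (A : op R I) i j :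
  entry (A^t*) i j = (entry A j i)^*.
Proof. by rewrite /entry !mxE. Qed.

Lemma op_decomp (I : finType) (A : op R I) :
  A = \sum_i \sum_j entry A i j *: ketbra R i j.
Proof.
apply: eq_op => a b; rewrite entry_sum (bigD1 a) //= entry_sum (bigD1 b) //=.
rewrite entryZ entry_mkop !eqxx mulr1 !big1 ?addr0 // => [i ia|j jb].
  rewrite entry_sum big1 // => j _.
  by rewrite entryZ entry_mkop eq_sym (negPf ia) mulr0.
by rewrite entryZ entry_mkop eqxx [b == j]eq_sym (negPf jb) mulr0.
Qed.

Definition expect (I : finType) (A : op R I) (v : I -> C) : C :=
  \sum_i \sum_j v i * entry A i j * (v j)^*.

Definition psd (I : finType) (A : op R I) := forall v : I -> C, 0 <= expect A v.

Lemma psdE (I : finType) (A : op R I) :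
  psd A <-> forall v : 'rV[C]_(#|{: I}|), 0 <= (v *m A *m v^t*) ord0 ord0.
Proof.
have E (v : 'rV[C]_(#|{: I}|)) : (v *m A *m v^t*) ord0 ord0 =
    \sum_i \sum_j v ord0 (enum_rank i) * entry A i j * (v ord0 (enum_rank j))^*.
  rewrite exchange_big mxE (reindex (@enum_rank I)) /=; last first.
    by apply: onW_bij; apply: enum_rank_bij.
  apply: eq_bigr => j _; rewrite mxE (reindex (@enum_rank I)) /=; last first.
    by apply: onW_bij; apply: enum_rank_bij.
  by rewrite mulr_suml; apply: eq_bigr => i _; rewrite !mxE.
split=> A0 v; first by rewrite E; apply: A0.
have := A0 (\row_k v (enum_val k)); rewrite E.
congr (0 <= _); apply: eq_bigr => i _; apply: eq_bigr => j _.
by rewrite !mxE !enum_rankK.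
Qed.

Lemma densityE (I : finType) (A : op R I) : density A <-> psd A /\ \tr A = 1.
Proof. by rewrite psdE. Qed.

Lemma expect_sum (I K : finType) (z : K -> C) (A : K -> op R I) v :
  expect (\sum_k z k *: A k) v = \sum_k z k * expect (A k) v.
Proof.
rewrite /expect; under [RHS]eq_bigr => k _ do rewrite mulr_sumr.
rewrite [RHS]exchange_big; apply: eq_bigr => i _.
under [RHS]eq_bigr => k _ do rewrite mulr_sumr.
rewrite [RHS]exchange_big; apply: eq_bigr => j _.
rewrite entry_sum mulr_sumr mulr_suml; apply: eq_bigr => k _.
by rewrite entryZ mulrCA !mulrA.
Qed.

Lemma psd_sum (I K : finType) (z : K -> C) (A : K -> op R I) :
  (forall k, 0 <= z k) -> (forall k, psd (A k)) -> psd (\sum_k z k *: A k).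
Proof.
by move=> z0 A0 v; rewrite expect_sum sumr_ge0 // => k _; rewrite mulr_ge0 // A0.
Qed.

(** Vectors are rows, so the rank-one operator of [e] carries the conjugate on its first index. *)
Definition pure (I : finType) (e : I -> C) : op R I :=
  mkop (fun i j => (e i)^* * e j).

Lemma expect_pure (I : finType) (e v : I -> C) :
  expect (pure e) v = (\sum_i v i * (e i)^*) * (\sum_i v i * (e i)^*)^*.
Proof.
rewrite rmorph_sum mulr_suml; apply: eq_bigr => i _.
rewrite mulr_sumr; apply: eq_bigr => j _.
rewrite entry_mkop rmorphM /= conjCK mulrA -[LHS]mulrA.
by congr (_ * _); apply: mulrC.
Qed.

Lemma psd_pure (I : finType) (e : I -> C) : psd (pure e).
Proof. by move=> v; rewrite expect_pure mul_conjC_ge0. Qed.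

Lemma Re_sum (K : Type) (r : seq K) (P : pred K) (F : K -> C) :
  complex.Re (\sum_(k <- r | P k) F k) = \sum_(k <- r | P k) complex.Re (F k).
Proof. exact: (raddf_sum (@complex.Re R : Rcomplex R -> R)). Qed.

Lemma Re_mulC (x : R) (z : C) : complex.Re (x%:C%C * z) = x * complex.Re z.
Proof. by case: z => a b /=; rewrite mul0r subr0. Qed.

End Entries.

(** * Entropy in an eigenbasis and its monotonicity under unital maps *)

Section Entropy.
Variable R : realType.
Local Notation C := R[i].

Definition eta (x : R) : R := - (x * log2 x).

(** Orthonormality and completeness are stored together: the first computes expectations, the second
    traces and resolutions of the identity. *)
Definition orthobasis (I : finType) (e : I -> I -> C) :=
  (forall k l, \sum_i e k i * (e l i)^* = (k == l)%:R) /\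
  (forall i j, \sum_k (e k i)^* * e k j = (i == j)%:R).



Definition rebuild (I : finType) (e : I -> I -> C) (a : I -> R) : op R I :=
  \sum_k (a k)%:C%C *: pure (e k).

Lemma entry_rebuild (I : finType) (e : I -> I -> C) (a : I -> R) i j :
  entry (rebuild e a) i j = \sum_k (a k)%:C%C * ((e k i)^* * e k j).
Proof. by rewrite entry_sum; apply: eq_bigr => k _; rewrite entryZ entry_mkop. Qed.


Lemma psd_spectral (I : finType) (A : op R I) : psd A ->
  exists e a, [/\ orthobasis e, forall k, 0 <= a k & A = rebuild e a].
Proof.
move=> /psdE A0.
have /orthomx_spectralP AE : A \is normalmx.
  by apply/adj_normal/real_form_hermsym => v; apply: ger0_real.
have Pu := spectral_unitarymx A; set P := spectralmx A in Pu AE.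
set D := spectral_diag A in AE.
have DE : diag_mx D = P *m A *m P^t*.
  by rewrite AE -invmx_unitary // !mulmxA mulmxV ?unitarymx_unit // mul1mx mulmxK ?unitarymx_unit.
(* An eigenvalue is the quadratic form of [A] at the corresponding row of [P]. *)
have D0 k : 0 <= D ord0 k.
  suff -> : D ord0 k = (row k P *m A *m (row k P)^t*) ord0 ord0 by [].
  have <- : diag_mx D k k = D ord0 k by rewrite mxE eqxx.
  by rewrite DE -row_mul !mxE; apply: eq_bigr => l _; rewrite !mxE.
have DR k : (complex.Re (D ord0 k))%:C%C = D ord0 k by rewrite RRe_real // ger0_real.
exists (fun k i => entry P k i), (fun k => complex.Re (D ord0 (enum_rank k))).
split.
- split=> i j.
    have /(congr1 (fun M : op R I => entry M i j)) := unitarymxP Pu.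
    rewrite entry_mul entry1 => <-; apply: eq_bigr => k _; congr (_ * _).
    by rewrite entry_adj.
  have /(congr1 (fun M : op R I => entry M i j)) := mulmx1C (unitarymxP Pu).
  rewrite entry_mul entry1 => <-; apply: eq_bigr => k _; congr (_ * _).
  by rewrite entry_adj.
- by move=> k; rewrite -ler0c DR.
apply: eq_op => i j; rewrite entry_rebuild [X in entry X](AE) invmx_unitary // entry_mul.
apply: eq_bigr => k _; rewrite entry_mul (bigD1 k) //= big1 ?addr0; last first.
  by move=> l lk; rewrite /entry [X in _ * X]mxE (inj_eq enum_rank_inj) (negPf lk) mulr0.
rewrite entry_adj /entry [X in _ * X * _]mxE eqxx mulr1n DR.
by rewrite mulrCA mulrA [X in X * _]mulrC -mulrA mulrCA.
Qed.

Lemma entropy_rebuild (I : finType) (e : I -> I -> C) (a : I -> R) :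
  orthobasis e -> entropy (rebuild e a) = \sum_k eta (a k).
Proof.
move=> [e1 e2]; set A := rebuild e a.
pose E : op R I := mkop e.
have EE : E *m E^t* = 1%:M.
  apply: eq_op => i j; rewrite entry_mul entry1 -e1.
  by apply: eq_bigr => k _; rewrite entry_adj !entry_mkop.
have Eu : E \is unitarymx by apply/unitarymxP.
pose da : 'rV[C]_(#|{: I}|) := \row_k (a (enum_val k))%:C%C.
have AE : A = E^t* *m diag_mx da *m E.
  apply: eq_op => i j; rewrite entry_rebuild entry_mul.
  apply: eq_bigr => k _; rewrite entry_mul (bigD1 k) //= big1 ?addr0; last first.
    by move=> l lk; rewrite /entry [X in _ * X]mxE (inj_eq enum_rank_inj) (negPf lk) mulr0.
  rewrite entry_adj !entry_mkop /entry [X in _ * X * _]mxE eqxx mulr1n mxE enum_rankK.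
  by rewrite mulrA [X in X * _]mulrC.
have /orthomx_spectralP AP : A \is normalmx.
  rewrite AE; apply/adj_normal/adj_unitary_diag => l; rewrite mxE.
  exact: conjc_real.
rewrite /entropy.
have -> : oplog A = E^t* *m diag_mx (map_mx (fun z => (log2 (complex.Re z))%:C%C) da) *m E.
  by apply: unitary_calculus (spectral_unit A) Eu _; rewrite -AE.
rewrite [X in X *m _]AE trace_unitary_mul // mulmx_diag trace_entry Re_sum -sumrN; apply: eq_bigr => k _.
rewrite /entry mxE eqxx mulr1n !mxE enum_rankK.
by rewrite Re_mulC.
Qed.

(** This is [ln x <= x - 1] at [x = t / s], multiplied by [s]; the case [s = 0] is treated apart. *)
Lemma ln_tangent (s t : R) : 0 <= s -> 0 < t ->
  - (s * ln s) <= - (s * ln t) + (t - s).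
Proof.
rewrite le_eqVlt => /predU1P[<- t0|s0 t0].
  by rewrite !mul0r oppr0 add0r addr0 ltW.
have := @le_ln1Dx R (t / s - 1); rewrite ltrBrDr addNr divr_gt0 // => /(_ isT).
rewrite addrC subrK ln_div // => /(ler_wpM2l (ltW s0)).
rewrite !mulrBr mulrCA divff ?gt_eqF // !mulr1 => H.
by rewrite -lerBlDl addrC opprK.
Qed.

Lemma ln2_gt0 : 0 < ln (2 : R).
Proof. by rewrite ln_gt0 // ltr1n. Qed.

(** Concavity of [eta] through tangent lines: row [j] uses the tangent at [t j], whose linear
    corrections cancel because the row sums to 1. Summing over [j] then uses the column sums. *)
Lemma sum_eta_stochastic (I J : finType) (D : J -> I -> R) (s : I -> R) (t : J -> R) :
  (forall j k, 0 <= D j k) -> (forall k, 0 <= s k) ->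
  (forall j, \sum_k D j k = 1) -> (forall k, \sum_j D j k = 1) ->
  (forall j, t j = \sum_k D j k * s k) ->
  \sum_k eta (s k) <= \sum_j eta (t j).
Proof.
move=> D0 s0 Dr Dc tE.
have row j : \sum_k D j k * - (s k * ln (s k)) <= - (t j * ln (t j)).
  have : 0 <= t j by rewrite tE sumr_ge0 // => k _; rewrite mulr_ge0.
  rewrite le_eqVlt => /predU1P[t0|t0].
    (* There is no tangent at [t j = 0], but then every product [D j k * s k] vanishes. *)
    rewrite -t0 mul0r oppr0 big1 // => k _; rewrite mulrN mulrA.
    have /psumr_eq0P : \sum_k D j k * s k = 0 by rewrite -tE.
    by move=> -> //; rewrite ?mul0r ?oppr0 // => l _; rewrite mulr_ge0.
  apply: (@le_trans _ _ (\sum_k D j k * (- (s k * ln (t j)) + (t j - s k)))).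
    by apply: ler_sum => k _; rewrite ler_wpM2l // ln_tangent.
  rewrite (eq_bigr (fun k => - ln (t j) * (D j k * s k) + (D j k * t j - D j k * s k))).
    by rewrite big_split /= sumrB -mulr_sumr -mulr_suml -tE Dr mul1r subrr addr0 mulNr mulrC.
  by move=> k _; rewrite mulrDr mulrBr mulrN mulNr mulrA [ln _ * _]mulrC.
have etaE x : eta x = - (x * ln x) / ln 2 by rewrite /eta /log2 mulrA mulNr.
rewrite (eq_bigr _ (fun k _ => etaE (s k))) (eq_bigr _ (fun j _ => etaE (t j))).
rewrite -!mulr_suml ler_pM2r ?invr_gt0 ?ln2_gt0 //.
apply: le_trans (ler_sum _ (fun j _ => row j)).
rewrite exchange_big; apply: ler_sum => k _.
by rewrite -mulr_suml Dc mul1r.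
Qed.

Lemma trace_sum (I K : finType) (A : K -> op R I) :
  \tr (\sum_k A k) = \sum_k \tr (A k).
Proof. exact: raddf_sum. Qed.

Lemma orthobasis_norm (I : finType) (e : I -> I -> C) k :
  orthobasis e -> \sum_i e k i * (e k i)^* = 1.
Proof. by move=> [e1 _]; rewrite e1 eqxx. Qed.

Lemma trace_pure (I : finType) (e : I -> I -> C) k : orthobasis e -> \tr (pure (e k)) = 1.
Proof.
move=> eb; rewrite trace_entry -(orthobasis_norm k eb); apply: eq_bigr => i _.
by rewrite entry_mkop mulrC.
Qed.

Lemma sum_pure (I : finType) (e : I -> I -> C) : orthobasis e -> \sum_k pure (e k) = 1%:M.
Proof.
move=> [_ e2]; apply: eq_op => i j; rewrite entry_sum entry1 -e2.
by apply: eq_bigr => k _; rewrite entry_mkop.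
Qed.

Lemma expect1 (I : finType) (e : I -> I -> C) k : orthobasis e -> expect 1%:M (e k) = 1.
Proof.
move=> eb; rewrite -[RHS](orthobasis_norm k eb); apply: eq_bigr => i _.
rewrite (bigD1 i) //= big1 ?addr0 => [|j ji]; first by rewrite entry1 eqxx mulr1.
by rewrite entry1 eq_sym (negPf ji) mulr0 mul0r.
Qed.

Lemma sum_expect (I : finType) (e : I -> I -> C) (A : op R I) : orthobasis e ->
  \sum_k expect A (e k) = \tr A.
Proof.
move=> [_ e2]; rewrite exchange_big trace_entry; apply: eq_bigr => i _.
have E j : \sum_k e k i * entry A i j * (e k j)^* = entry A i j * (j == i)%:R.
  rewrite -e2 mulr_sumr; apply: eq_bigr => k _.
  by rewrite mulrAC [RHS]mulrC; congr (_ * _); rewrite mulrC.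
rewrite exchange_big (bigD1 i) //= E eqxx mulr1 big1 ?addr0 // => j ji.
by rewrite E (negPf ji) mulr0.
Qed.

Lemma expect_rebuild (I : finType) (e : I -> I -> C) a k :
  orthobasis e -> expect (rebuild e a) (e k) = (a k)%:C%C.
Proof.
move=> [e1 _]; rewrite expect_sum (bigD1 k) //= big1 ?addr0 => [|l lk].
  by rewrite expect_pure e1 eqxx mul1r rmorph1 mulr1.
by rewrite expect_pure e1 eq_sym (negPf lk) mul0r mulr0.
Qed.

(** The spectrum of [Phi A] is the image of that of [A] under the matrix [D] of expectations of
    [Phi (pure (e k))] in the eigenbasis [f]. Positivity makes [D] nonnegative, unitality gives its
    row sums and trace preservation its column sums. *)
Lemma entropy_le_unital (I J : finType) (Phi : op R I -> op R J) (A : op R I) :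
  (forall (z : I -> C) (B : I -> op R I),
     Phi (\sum_k z k *: B k) = \sum_k z k *: Phi (B k)) ->
  (forall B, psd B -> psd (Phi B)) ->
  (forall B, \tr (Phi B) = \tr B) ->
  Phi 1%:M = 1%:M ->
  psd A -> entropy A <= entropy (Phi A).
Proof.
move=> lin pos tp unital A0.
have [e [s [eb s0 AE]]] := psd_spectral A0.
have [f [t [fb _ PE]]] := psd_spectral (pos _ A0).
rewrite PE [in X in X <= _]AE !entropy_rebuild //.
pose D j k := expect (Phi (pure (e k))) (f j).
have D0 j k : 0 <= D j k by apply: pos; apply: psd_pure.
have DR j k : (complex.Re (D j k))%:C%C = D j k by rewrite RRe_real // ger0_real.
have tE j : (t j)%:C%C = \sum_k (s k)%:C%C * D j k.
  by rewrite -expect_sum -lin -/(rebuild e s) -AE PE expect_rebuild.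
apply: (@sum_eta_stochastic _ _ (fun j k => complex.Re (D j k))) => //.
- by move=> j k; rewrite -ler0c DR.
- move=> j; rewrite -Re_sum -[RHS]/(complex.Re 1); congr complex.Re.
  rewrite -(expect1 j fb) -unital -(sum_pure eb).
  have -> : \sum_k pure (e k) = \sum_k 1 *: pure (e k).
    by apply: eq_bigr => k _; rewrite scale1r.
  rewrite lin expect_sum; apply: eq_bigr => k _.
  by rewrite mul1r.
- move=> k; rewrite -Re_sum -[RHS]/(complex.Re 1); congr complex.Re.
  by rewrite sum_expect // tp trace_pure.
- move=> j; have /(congr1 (@complex.Re R)) := tE j.
  rewrite Re_sum /= => ->; apply: eq_bigr => k _.
  by rewrite Re_mulC mulrC.
Qed.

End Entropy.

(** * The maximal entropy *)

Section MaxEntropy.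
Variable R : realType.
Local Notation C := R[i].

Lemma trace_rebuild (I : finType) (e : I -> I -> C) a : orthobasis e ->
  \tr (rebuild e a) = (\sum_k a k)%:C%C.
Proof.
move=> eb; rewrite trace_sum rmorph_sum; apply: eq_bigr => k _.
by rewrite mxtraceZ trace_pure // mulr1.
Qed.

Lemma psd_rebuild (I : finType) (e : I -> I -> C) (a : I -> R) :
  (forall k, 0 <= a k) -> psd (rebuild e a).
Proof.
by move=> a0; apply: psd_sum => k; [rewrite ler0c|apply: psd_pure].
Qed.

Lemma density_spectral (I : finType) (A : op R I) : density A ->
  exists e a, [/\ orthobasis e, forall k, 0 <= a k, \sum_k a k = 1 & A = rebuild e a].
Proof.
move=> /densityE[/psd_spectral[e [a [eb a0 AE]]] trA]; exists e, a; split=> //.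
by apply: (@complexI R); rewrite -(trace_rebuild a eb) -AE trA rmorph1.
Qed.

Lemma etaV (n : nat) : n%:R * eta (n%:R^-1 : R) = log2 n%:R.
Proof.
have [->|n0] := posnP n; first by rewrite mul0r /log2 ln0 ?mul0r.
rewrite /eta mulrN mulVKf ?pnatr_eq0 ?gtn_eqF //.
by rewrite /log2 lnV ?posrE ?ltr0n // mulNr opprK.
Qed.

(** The constant matrix with entries [#|I|%:R^-1] is doubly stochastic and flattens every spectrum
    to the uniform one. *)
Lemma entropy_le_log (I : finType) (A : op R I) : density A ->
  entropy A <= log2 #|I|%:R.
Proof.
move=> /density_spectral[e [a [eb a0 a1 ->]]]; rewrite entropy_rebuild //.
(* Trace 1 excludes an empty [I]. *)
have I0 : (0 < #|I|)%N.
  rewrite lt0n; apply/eqP => /card0_eq I0; move: a1; rewrite big1; last by move=> k; have := I0 k.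
  by move/eqP; rewrite eq_sym oner_eq0.
have nI : #|I|%:R != 0 :> R by rewrite pnatr_eq0 -lt0n.
rewrite -etaV mulr_natl -sumr_const.
apply: (@sum_eta_stochastic _ _ _ (fun _ _ => #|I|%:R^-1)) => //.
- by move=> j; rewrite sumr_const -[LHS]mulr_natl divff.
- by move=> j; rewrite sumr_const -[LHS]mulr_natl divff.
- by move=> j; rewrite -mulr_sumr a1 mulr1.
Qed.

Lemma entropy_mixed (I : finType) :
  entropy (#|I|%:R^-1 *: 1%:M : op R I) = log2 #|I|%:R.
Proof.
pose e (i j : I) : C := (i == j)%:R.
have eb : orthobasis e.
  by split=> i j; rewrite (bigD1 i) //= big1 ?addr0 /e ?eqxx => [|k ki];
    rewrite ?rmorph_nat ?mul1r ?[j == i]eq_sym // ?(negPf ki) ?mul0r //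
     eq_sym (negPf ki) ?mul0r.
have -> : (#|I|%:R^-1 *: 1%:M : op R I) = rebuild e (fun=> #|I|%:R^-1).
  by rewrite /rebuild -scaler_sumr sum_pure // fmorphV rmorph_nat.
by rewrite entropy_rebuild // sumr_const -etaV mulr_natl.
Qed.

End MaxEntropy.

(** * Tensor products and additivity of entropy *)

Section Tensor.
Variable R : realType.
Local Notation C := R[i].

Lemma sum_prod_row (S : comPzSemiRingType) (I : finType) m (F : 'I_m -> I -> S) :
  \sum_(x : 'rV[I]_m) \prod_k F k (x ord0 k) = \prod_k \sum_i F k i.
Proof.
rewrite bigA_distr_bigA (reindex (fun f : {ffun 'I_m -> I} => \row_k f k)) /=.
  by apply: eq_bigr => f _; apply: eq_bigr => k _; rewrite mxE.
exists (fun x : 'rV_m => [ffun k => x ord0 k]) => [f|x] _.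
  by apply/ffunP => k; rewrite ffunE mxE.
by apply/rowP => k; rewrite mxE ffunE.
Qed.

Lemma prod_eq_row (S : comPzSemiRingType) (I : finType) m (x y : 'rV[I]_m) :
  \prod_k (x ord0 k == y ord0 k)%:R = (x == y)%:R :> S.
Proof.
have [->|xy] := eqVneq x y; first by rewrite big1 // => k _; rewrite eqxx.
have /existsP[k xyk] : [exists k, x ord0 k != y ord0 k].
  rewrite -negb_forall; apply: contra xy => /forallP xy.
  by apply/eqP/rowP => k; apply/eqP.
by rewrite (bigD1 k) //= (negPf xyk) mul0r.
Qed.

Lemma entry_tensor (I : finType) m (A : 'I_m -> op R I) x y :
  entry (tensor_family A) x y = \prod_k entry (A k) (x ord0 k) (y ord0 k).
Proof. exact: entry_mkop. Qed.

Lemma eq_tensor (I : finType) m (A B : 'I_m -> op R I) :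
  A =1 B -> tensor_family A = tensor_family B.
Proof.
by move=> AB; apply: eq_op => x y; rewrite !entry_tensor; apply: eq_bigr => k _; rewrite AB.
Qed.

Lemma trace_tensor (I : finType) m (A : 'I_m -> op R I) :
  \tr (tensor_family A) = \prod_k \tr (A k).
Proof.
rewrite trace_entry; under [RHS]eq_bigr => k _ do rewrite trace_entry.
by rewrite -sum_prod_row; apply: eq_bigr => x _; rewrite entry_tensor.
Qed.

Lemma tensor_sum (I K : finType) m (A : 'I_m -> K -> op R I) :
  tensor_family (fun k => \sum_i A k i) =
  \sum_(x : 'rV[K]_m) tensor_family (fun k => A k (x ord0 k)).
Proof.
apply: eq_op => a b; rewrite entry_tensor entry_sum.
under eq_bigr => k _ do rewrite entry_sum.
by rewrite -sum_prod_row; apply: eq_bigr => x _; rewrite entry_tensor.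
Qed.

Lemma tensorZ (I : finType) m (z : 'I_m -> C) (A : 'I_m -> op R I) :
  tensor_family (fun k => z k *: A k) = (\prod_k z k) *: tensor_family A.
Proof.
apply: eq_op => a b; rewrite entryZ !entry_tensor -big_split.
by apply: eq_bigr => k _; rewrite entryZ.
Qed.

Lemma tensor1 (I : finType) m :
  tensor_family (fun=> 1%:M) = 1%:M :> op R 'rV[I]_m.
Proof.
apply: eq_op => a b; rewrite entry_tensor entry1 -prod_eq_row.
by apply: eq_bigr => k _; rewrite entry1.
Qed.

Definition tensor_vec (I : finType) m (e : 'I_m -> I -> I -> C) (x y : 'rV[I]_m) : C :=
  \prod_k e k (x ord0 k) (y ord0 k).

Lemma orthobasis_tensor (I : finType) m (e : 'I_m -> I -> I -> C) :
  (forall k, orthobasis (e k)) -> orthobasis (tensor_vec e).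
Proof.
move=> eb; split=> x y; rewrite -prod_eq_row.
  have -> : \prod_k (x ord0 k == y ord0 k)%:R =
      \prod_k \sum_i e k (x ord0 k) i * (e k (y ord0 k) i)^*.
    by apply: eq_bigr => k _; have [-> _] := eb k.
  rewrite -sum_prod_row; apply: eq_bigr => z _.
  by rewrite rmorph_prod -big_split.
have -> : \prod_k (x ord0 k == y ord0 k)%:R =
    \prod_k \sum_i (e k i (x ord0 k))^* * e k i (y ord0 k).
  by apply: eq_bigr => k _; have [_ ->] := eb k.
rewrite -sum_prod_row; apply: eq_bigr => z _.
by rewrite rmorph_prod -big_split.
Qed.

Lemma tensor_rebuild (I : finType) m (e : 'I_m -> I -> I -> C) (a : 'I_m -> I -> R) :
  tensor_family (fun k => rebuild (e k) (a k)) =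
  rebuild (tensor_vec e) (fun x => \prod_k a k (x ord0 k)).
Proof.
rewrite /rebuild tensor_sum; apply: eq_bigr => x _.
rewrite tensorZ rmorph_prod; congr (_ *: _); apply: eq_op => y z.
rewrite entry_tensor entry_mkop rmorph_prod -big_split.
by apply: eq_bigr => k _; rewrite entry_mkop.
Qed.

Lemma spectral_family (I : finType) m (A : 'I_m -> op R I) : (forall k, density (A k)) ->
  exists e a, forall k, [/\ orthobasis (e k), forall i, 0 <= a k i, \sum_i a k i = 1 &
    A k = rebuild (e k) (a k)].
Proof.
move=> dA; have /choice[ea eaP] : forall k, exists ea : (I -> I -> C) * (I -> R),
    [/\ orthobasis ea.1, forall i, 0 <= ea.2 i, \sum_i ea.2 i = 1 &
    A k = rebuild ea.1 ea.2].
  by move=> k; have [e [a ?]] := density_spectral (dA k); exists (e, a).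
by exists (fun k => (ea k).1), (fun k => (ea k).2).
Qed.

Lemma density_tensor (I : finType) m (A : 'I_m -> op R I) :
  (forall k, density (A k)) -> density (tensor_family A).
Proof.
move=> dA; have [e [a eaP]] := spectral_family dA; apply/densityE; split.
  rewrite (eq_tensor (B := fun k => rebuild (e k) (a k))) ?tensor_rebuild; last by move=> k; have [] := eaP k.
  by apply: psd_rebuild => x; apply: prodr_ge0 => k _; have [] := eaP k.
rewrite trace_tensor big1 // => k _.
by have /densityE[] := dA k.
Qed.

Lemma log2_prod m (a : 'I_m -> R) : (forall k, 0 < a k) ->
  log2 (\prod_k a k) = \sum_k log2 (a k).
Proof.
move=> a0; rewrite /log2 -mulr_suml; congr (_ / _).
suff [] : ln (\prod_k a k) = \sum_k ln (a k) /\ 0 < \prod_k a k by [].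
elim/big_ind2: _ => [|x y z t [xy y0] [zt t0]|k _]; rewrite ?ln1 ?a0 //.
by rewrite lnM ?posrE // xy zt mulr_gt0.
Qed.

(** A Leibniz rule coming from the logarithm of a product. If some factor is zero, both sides
    vanish: its own term through [eta 0 = 0], every other term through the zero factor. *)
Lemma eta_prod m (a : 'I_m -> R) : (forall k, 0 <= a k) ->
  eta (\prod_k a k) = \sum_k eta (a k) * \prod_(l | l != k) a l.
Proof.
move=> a0; have [/existsP[k /eqP ak]|] := boolP [exists k, a k == 0].
  have -> : eta (\prod_k a k) = 0 by rewrite (bigD1 k) //= ak mul0r /eta mul0r oppr0.
  rewrite big1 // => l _; have [->|lk] := eqVneq l k.
    by rewrite ak /eta mul0r oppr0 mul0r.
  by rewrite (bigD1 k) 1?eq_sym //= ak mul0r mulr0.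
rewrite negb_exists => /forallP ak; rewrite /eta log2_prod; last first.
  by move=> k; rewrite lt_neqAle eq_sym ak a0.
rewrite mulr_sumr -sumrN; apply: eq_bigr => k _.
by rewrite (bigD1 k) //= mulNr mulrAC.
Qed.

(** The eigenvalues of the tensor product are products, so [eta_prod] splits the entropy into one
    sum for each [k]. In that sum the other factors are probability distributions and sum to 1. *)
Lemma entropy_tensor (I : finType) m (A : 'I_m -> op R I) :
  (forall k, density (A k)) -> entropy (tensor_family A) = \sum_k entropy (A k).
Proof.
move=> dA; have [e [a eaP]] := spectral_family dA.
have a0 k i : 0 <= a k i by have [] := eaP k.
rewrite (eq_tensor (B := fun k => rebuild (e k) (a k))) ?tensor_rebuild; last by move=> k; have [] := eaP k.
rewrite entropy_rebuild; last by apply: orthobasis_tensor => k; have [] := eaP k.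
transitivity (\sum_(x : 'rV[I]_m) \sum_k
    eta (a k (x ord0 k)) * \prod_(l | l != k) a l (x ord0 l)).
  by apply: eq_bigr => x _; rewrite eta_prod.
rewrite exchange_big; apply: eq_bigr => k _.
have [eb _ _ ->] := eaP k; rewrite entropy_rebuild //.
(* Putting [eta] inside the [k]-th factor turns the summand into a full product, to which
   [sum_prod_row] applies. *)
pose F l i := if l == k then eta (a l i) else a l i.
transitivity (\sum_(x : 'rV[I]_m) \prod_l F l (x ord0 l)).
  apply: eq_bigr => x _; rewrite [RHS](bigD1 k) //= {1}/F eqxx; congr (_ * _).
  by apply: eq_bigr => l /negPf lk; rewrite /F lk.
rewrite sum_prod_row (bigD1 k) //= [X in _ * X]big1 ?mulr1.
  by apply: eq_bigr => i _; rewrite /F eqxx.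
by move=> l /negPf lk; rewrite /F lk; have [] := eaP l.
Qed.

End Tensor.

(** * Holevo information *)

Section Holevo.
Variable R : realType.
Local Notation C := R[i].

Lemma density_convex (I K : finType) (p : K -> R) (rho : K -> op R I) :
  (forall k, 0 <= p k) -> \sum_k p k = 1 -> (forall k, density (rho k)) ->
  density (\sum_k (p k)%:C%C *: rho k).
Proof.
move=> p0 p1 drho; apply/densityE; split.
  by apply: psd_sum => k; [rewrite ler0c|have /densityE[] := drho k].
rewrite trace_sum -(rmorph1 (real_complex R)) -p1 rmorph_sum.
by apply: eq_bigr => k _; rewrite mxtraceZ; have /densityE[_ ->] := drho k; rewrite mulr1.
Qed.

(** The average output has entropy at most [log2 #|J|%:R] and each output at least [s], which gives
    the upper bound. The uniform ensemble of the [rho k] attains it: its average output is maximally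
    mixed, and the two bounds on each output entropy make it equal to [s]. *)
Lemma holevo_max (I J K : finType) (L : op R I -> op R J) (s : R) (rho : K -> op R I) :
  (forall r, density r -> density (L r)) ->
  (forall r, density r -> s <= entropy (L r)) ->
  (0 < #|K|)%N -> (forall k, density (rho k)) ->
  L (\sum_k (#|K|%:R^-1)%:C%C *: rho k) = #|J|%:R^-1 *: 1%:M ->
  (forall k, entropy (L (rho k)) <= s) ->
  holevo_values L (log2 #|J|%:R - s) /\ ubound (holevo_values L) (log2 #|J|%:R - s).
Proof.
move=> Ld Ls K0 drho Lmix Lrho.
have sumK (z : R) : \sum_(k < #|K|) #|K|%:R^-1 * z = z.
  rewrite sumr_const card_ord -[LHS]mulr_natl mulVKf // pnatr_eq0.
  by rewrite gtn_eqF.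
split=> [|x [k [p [r [p0 p1 dr ->]]]]].
  exists #|K|, (fun=> #|K|%:R^-1), (fun k => rho (enum_val k)); split=> //.
  - by rewrite -[RHS]sumK; apply: eq_bigr => k _; rewrite mulr1.
  have -> : \sum_(k < #|K|) (#|K|%:R^-1)%:C%C *: rho (enum_val k) =
      \sum_k (#|K|%:R^-1)%:C%C *: rho k.
    rewrite [RHS](reindex (@enum_val _ K)) //=.
    exact/onW_bij/enum_val_bij.
  rewrite Lmix entropy_mixed; congr (_ - _); rewrite -[LHS]sumK.
  apply: eq_bigr => k _; congr (_ * _); apply: le_anti.
  by rewrite Ls ?Lrho.
apply: lerB; first by apply/entropy_le_log/Ld/density_convex.
rewrite -[leLHS]mul1r -p1 mulr_suml.
by apply: ler_sum => i _; rewrite ler_wpM2l // Ls.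
Qed.

End Holevo.

(** * Channels given by a basis permutation and a partial trace *)

Section Twist.
Variable R : realType.
Local Notation C := R[i].

(** For bijective [c], this conjugates [tensor2 rho sigma] by the permutation of the product basis
    inverse to [c] and traces out the second factor. [sigma] comes first so that [twist c sigma] is
    the channel. *)
Definition twist (I : finType) (c : I * I -> I * I) (sigma rho : op R I) : op R I :=
  mkop (fun a b => \sum_j entry rho (c (a, j)).1 (c (b, j)).1 *
                          entry sigma (c (a, j)).2 (c (b, j)).2).

Lemma twist_suml (I K : finType) c (z : K -> C) (A : K -> op R I) rho :
  twist c (\sum_k z k *: A k) rho = \sum_k z k *: twist c (A k) rho.
Proof.
apply: eq_op => a b; rewrite entry_mkop entry_sum.
under [RHS]eq_bigr => k _ do rewrite entryZ entry_mkop mulr_sumr.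
rewrite [RHS]exchange_big; apply: eq_bigr => j _.
rewrite entry_sum mulr_sumr; apply: eq_bigr => k _.
by rewrite entryZ mulrCA.
Qed.

Lemma twist_sumr (I K : finType) c (z : K -> C) (A : K -> op R I) sigma :
  twist c sigma (\sum_k z k *: A k) = \sum_k z k *: twist c sigma (A k).
Proof.
apply: eq_op => a b; rewrite entry_mkop entry_sum.
under [RHS]eq_bigr => k _ do rewrite entryZ entry_mkop mulr_sumr.
rewrite [RHS]exchange_big; apply: eq_bigr => j _.
rewrite entry_sum mulr_suml; apply: eq_bigr => k _.
by rewrite entryZ mulrA.
Qed.

(** Each traced-out index [j] contributes one rank-one term; positivity of [twist] follows from this
    by bilinearity. *)
Lemma twist_pure (I : finType) c (e f : I -> C) :
  twist c (pure e) (pure f) = \sum_j 1 *: pure (fun a => f (c (a, j)).1 * e (c (a, j)).2).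
Proof.
apply: eq_op => a b; rewrite entry_mkop entry_sum; apply: eq_bigr => j _.
by rewrite entryZ mul1r !entry_mkop rmorphM mulrACA.
Qed.

Lemma psd_twist (I : finType) c (sigma rho : op R I) :
  psd sigma -> psd rho -> psd (twist c sigma rho).
Proof.
move=> /psd_spectral[e [s [_ s0 ->]]] /psd_spectral[f [r [_ r0 ->]]].
rewrite /rebuild twist_suml; apply: psd_sum => k; first by rewrite ler0c.
rewrite twist_sumr; apply: psd_sum => l; first by rewrite ler0c.
by rewrite twist_pure; apply: psd_sum => j; [exact: ler01|exact: psd_pure].
Qed.

Lemma trace_twist (I : finType) c (sigma rho : op R I) : bijective c ->
  \tr (twist c sigma rho) = \tr rho * \tr sigma.
Proof.
move=> cb; rewrite !trace_entry.
under eq_bigr => a _ do rewrite entry_mkop.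
rewrite pair_bigA /= big_distrlr pair_bigA /= [RHS](reindex c) /=.
  by apply: eq_bigr => -[a j].
exact: onW_bij.
Qed.

Lemma density_twist (I : finType) c (sigma rho : op R I) : bijective c ->
  density sigma -> density rho -> density (twist c sigma rho).
Proof.
move=> cb /densityE[s0 s1] /densityE[r0 r1]; apply/densityE; split.
  exact: psd_twist.
by rewrite trace_twist // s1 r1 mulr1.
Qed.

(** Injectivity in [a] turns the entries of the identity into [a == b]. Injectivity in [j] makes the
    diagonal sum run over the whole diagonal of [rho], giving its trace. *)
Lemma twist_unital (I : finType) c (rho : op R I) :
  (forall a, injective (fun j => (c (a, j)).1)) ->
  (forall j, injective (fun a => (c (a, j)).2)) ->
  \tr rho = 1 -> twist c 1%:M rho = 1%:M.
Proof.
move=> c1 c2 r1; apply: eq_op => a b; rewrite entry_mkop entry1.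
under eq_bigr => j _ do rewrite entry1 (inj_eq (c2 j)).
have [->|ab] := eqVneq a b; last by rewrite big1 // => j _; rewrite mulr0.
rewrite -[RHS]r1 trace_entry [RHS](reindex (fun j => (c (b, j)).1)) /=.
  by apply: eq_bigr => j _; rewrite mulr1.
exact/onW_bij/injF_bij/c1.
Qed.

(** The input [rho] is frozen and [sigma] is the variable: the resulting map is unital, so
    [entropy_le_unital] applies to it. *)
Lemma entropy_le_twist (I : finType) c (sigma rho : op R I) : bijective c ->
  (forall a, injective (fun j => (c (a, j)).1)) ->
  (forall j, injective (fun a => (c (a, j)).2)) ->
  density sigma -> density rho -> entropy sigma <= entropy (twist c sigma rho).
Proof.
move=> cb c1 c2 /densityE[s0 _] /densityE[r0 r1].
apply: (entropy_le_unital (Phi := twist c ^~ rho)) => //.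
- by move=> z A; apply: twist_suml.
- by move=> A A0; apply: psd_twist.
- by move=> A; rewrite trace_twist // r1 mul1r.
- exact: twist_unital.
Qed.

(** [c] acts separately on each of the [m] coordinate pairs. With it, the [m]-th power of a twist is
    again a twist, over a larger index type. *)
Definition row_pair (I : finType) (c : I * I -> I * I) m
    (p : 'rV[I]_m * 'rV[I]_m) : 'rV[I]_m * 'rV[I]_m :=
  (\row_k (c (p.1 ord0 k, p.2 ord0 k)).1, \row_k (c (p.1 ord0 k, p.2 ord0 k)).2).

Lemma row_pair_bij (I : finType) c m : bijective c -> bijective (@row_pair I c m).
Proof.
move=> [d cK dK]; exists (row_pair d (m:=m)) => -[x y]; congr pair; apply/rowP => k;
  by rewrite !mxE -surjective_pairing ?(cK, dK).
Qed.

Lemma row_pair_inj1 (I : finType) c m a : (forall a, injective (fun j => (c (a, j)).1)) ->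
  injective (fun j => (@row_pair I c m (a, j)).1).
Proof.
by move=> c1 x y /rowP xy; apply/rowP => k; have := xy k; rewrite !mxE => /c1.
Qed.

Lemma row_pair_inj2 (I : finType) c m j : (forall j, injective (fun a => (c (a, j)).2)) ->
  injective (fun a => (@row_pair I c m (a, j)).2).
Proof.
by move=> c2 x y /rowP xy; apply/rowP => k; have := xy k; rewrite !mxE => /c2.
Qed.

Lemma twist_tensor (I : finType) c m (sigma rho : 'I_m -> op R I) :
  twist (row_pair c (m:=m)) (tensor_family sigma) (tensor_family rho) =
  tensor_family (fun k => twist c (sigma k) (rho k)).
Proof.
apply: eq_op => a b; rewrite entry_mkop entry_tensor.
under [RHS]eq_bigr => k _ do rewrite entry_mkop.
rewrite -sum_prod_row; apply: eq_bigr => j _.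
rewrite !entry_tensor -big_split; apply: eq_bigr => k _.
by rewrite !mxE.
Qed.

Lemma ketbra_tensor (I : finType) m (x y : 'rV[I]_m) :
  tensor_family (fun k => ketbra R (x ord0 k) (y ord0 k)) = ketbra R x y.
Proof.
apply: eq_op => a b; rewrite entry_tensor entry_mkop -mulnb natrM -!prod_eq_row -big_split.
by apply: eq_bigr => k _; rewrite entry_mkop -mulnb natrM.
Qed.

(** By linearity only the matrix units matter, and those of the tensor power are tensor products of
    matrix units. *)
Lemma channel_power_twist (I : finType) c m (sigma : op R I) (rho : op R 'rV[I]_m) :
  channel_power (twist c sigma) rho =
  twist (row_pair c (m:=m)) (tensor_family (fun=> sigma)) rho.
Proof.
rewrite [in RHS](op_decomp rho) pair_bigA /= twist_sumr /channel_power pair_bigA /=.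
by apply: eq_bigr => -[x y] _; rewrite /= -ketbra_tensor twist_tensor.
Qed.

End Twist.

(** * Weyl operators and stabilizer projectors *)

Section PositiveOps.
Variable R : realType.
Local Notation C := R[i].

Lemma psd_conj (I : finType) (A B : op R I) : psd A -> psd (B *m A *m B^t*).
Proof.
move=> /psdE A0; apply/psdE => v; have := A0 (v *m B).
by rewrite trmx_mul map_mxM !mulmxA.
Qed.

Lemma psd1 (I : finType) : psd (1%:M : op R I).
Proof.
move=> v; apply: sumr_ge0 => i _; apply: sumr_ge0 => j _; rewrite entry1.
have [->|_] := eqVneq i j; first by rewrite mulr1 mul_conjC_ge0.
by rewrite mulr0 mul0r.
Qed.

Lemma trace_psd_ge0 (I : finType) (A : op R I) : psd A -> 0 <= \tr A.
Proof.
move=> /psd_spectral[e [a [eb a0 ->]]].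
by rewrite trace_rebuild // ler0c sumr_ge0.
Qed.

End PositiveOps.

(** * The primitive root of unity and its powers *)

Section Omega.
Variables (R : realType) (d : nat).
Hypotheses (d_prime : prime d) (d_odd : odd d).
Local Notation C := R[i].
Local Notation w := (omega R d).
Local Notation "'omg' x" := (@omega_pow R d x) (at level 10, x at level 8).

Let d_gt2 : (2 < d)%N.
Proof. by case: d d_prime d_odd => [|[|[|]]]. Qed.

Lemma omegaX k : w ^+ k = (cos (2 * pi / d%:R *+ k) +i* sin (2 * pi / d%:R *+ k))%C.
Proof.
elim: k => [|k IHk]; first by rewrite !mulr0n cos0 sin0.
rewrite exprS IHk (mulrS (2 * pi / d%:R)) cosD sinD.
by congr Complex; rewrite addrC.
Qed.

Lemma omegaXd : w ^+ d = 1.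
Proof.
rewrite omegaX -mulr_natr divfK ?pnatr_eq0; last by case: d d_gt2.
by rewrite mulr_natl cos2pi sin2pi.
Qed.

(** Since [d > 2], the angle lies strictly between 0 and [pi], so the imaginary part is positive. *)
Lemma omega_neq1 : w != 1.
Proof.
rewrite eq_complex negb_and /= orbC gt_eqF //.
have d0 : 0 < d%:R :> R by rewrite ltr0n (ltn_trans _ d_gt2).
apply: sin_gt0_pi; rewrite divr_gt0 ?mulr_gt0 ?pi_gt0 //=.
by rewrite ltr_pdivrMr // mulrC ltr_pM2l ?pi_gt0 // ltr_nat.
Qed.

(** The order of [w] divides the prime [d] and is not 1. *)
Lemma omega_prim : d.-primitive_root w.
Proof.
have [m prim_m md] := prim_order_exists (prime_gt0 d_prime) omegaXd.
have [m1|m1] := eqVneq m 1%N.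
  by have := prim_expr_order prim_m; rewrite m1 expr1 => /eqP; rewrite (negPf omega_neq1).
by move: prim_m; rewrite (prime_nt_dvdP d_prime m1 md).
Qed.

Lemma omega_norm : w * w^* = 1.
Proof.
rewrite -normCK (_ : `|w| = 1) ?expr1n //; apply/eqP.
by rewrite -(@pexpr_eq1 _ _ d) ?(prime_gt0 d_prime) // -normrX omegaXd normr1.
Qed.

Lemma omega_pow_nat (k : nat) : omg k%:R = w ^+ k.
Proof.
rewrite /omega_pow Zp_nat /= Fp_cast //.
by rewrite (prim_expr_mod omega_prim).
Qed.

Lemma omega_pow0 : omg 0 = 1.
Proof. by []. Qed.

Lemma omega_powD x y : omg (x + y) = omg x * omg y.
Proof.
rewrite -[x in LHS]natr_Zp -[y in LHS]natr_Zp -natrD omega_pow_nat.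
by rewrite exprD.
Qed.

Lemma omega_pow_sum (K : Type) (r : seq K) (F : K -> 'F_d) :
  omg (\sum_(k <- r) F k) = \prod_(k <- r) omg (F k).
Proof. exact: (big_morph _ omega_powD). Qed.

Lemma omega_powX x k : omg x ^+ k = omg (x * k%:R).
Proof. by rewrite -[x in RHS]natr_Zp -natrM omega_pow_nat exprM. Qed.

Lemma omega_pow_norm x : omg x * (omg x)^* = 1.
Proof. by rewrite /omega_pow rmorphXn /= -exprMn omega_norm expr1n. Qed.

Lemma omega_pow_neq0 x : omg x != 0.
Proof.
apply/eqP => x0; have := omega_pow_norm x; rewrite x0 mul0r => /eqP.
by rewrite eq_sym oner_eq0.
Qed.

Lemma omega_powN x : omg (- x) = (omg x)^*.
Proof.
by apply: (mulfI (omega_pow_neq0 x)); rewrite -omega_powD subrr omega_pow_norm.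
Qed.

Lemma omega_pow_inj : injective (@omega_pow R d).
Proof.
move=> x y /eqP; rewrite /omega_pow (eq_prim_root_expr omega_prim).
have lt (z : 'F_d) : (z < d)%N by rewrite -[ltnRHS](Fp_cast d_prime).
by rewrite !modn_small ?lt // => /eqP/val_inj.
Qed.

End Omega.

Section Dot.
Variables (d n : nat).
Implicit Types p q : 'rV['F_d]_n.

Lemma dotC p q : dot p q = dot q p.
Proof. by apply: eq_bigr => k _; rewrite mulrC. Qed.

Lemma dotDl p p' q : dot (p + p') q = dot p q + dot p' q.
Proof. by rewrite -big_split; apply: eq_bigr => k _; rewrite mxE mulrDl. Qed.

Lemma dotDr p q q' : dot p (q + q') = dot p q + dot p q'.
Proof. by rewrite dotC dotDl !(dotC p). Qed.

Lemma dotZl a p q : dot (a *: p) q = a * dot p q.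
Proof. by rewrite mulr_sumr; apply: eq_bigr => k _; rewrite mxE mulrA. Qed.

Lemma dotZr a p q : dot p (a *: q) = a * dot p q.
Proof. by rewrite dotC dotZl dotC. Qed.

Lemma dotNl p q : dot (- p) q = - dot p q.
Proof. by rewrite -scaleN1r dotZl mulN1r. Qed.

Lemma dotNr p q : dot p (- q) = - dot p q.
Proof. by rewrite dotC dotNl dotC. Qed.

Lemma dot0l q : dot 0 q = 0.
Proof. by rewrite -(scale0r q) dotZl mul0r. Qed.

Lemma dot_delta p k : dot p (delta_mx ord0 k) = p ord0 k.
Proof.
rewrite /dot (bigD1 k) //= big1 => [|l lk]; first by rewrite mxE !eqxx mulr1 addr0.
by rewrite mxE (negPf lk) andbF mulr0.
Qed.

End Dot.

Section Weyl.
Variables (R : realType) (d n : nat).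
Hypotheses (d_prime : prime d) (d_odd : odd d).
Local Notation C := R[i].
Local Notation "'omg' x" := (@omega_pow R d x) (at level 10, x at level 8).
Local Notation V := ('rV['F_d]_n * 'rV['F_d]_n)%type.
Local Notation omega_powD := (omega_powD R d_prime d_odd).
Local Notation omega_powN := (omega_powN R d_prime d_odd).

Lemma card_F : #|'F_d| = d.
Proof. by rewrite card_ord Fp_cast. Qed.

Lemma card_rowF : #|{: 'rV['F_d]_n}| = (d ^ n)%N.
Proof. by rewrite card_mx card_F mul1n. Qed.

(** If [k] has a nonzero coordinate [i], translating [x] by the [i]-th unit vector multiplies the
    sum by a root of unity other than 1, so the sum is zero. *)
Lemma char_sum (k : 'rV['F_d]_n) :
  \sum_(x : 'rV['F_d]_n) omg (dot k x) = d%:R ^+ n * (k == 0)%:R.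
Proof.
have [->|k0] := eqVneq k 0.
  under eq_bigr => x _ do rewrite dot0l.
  by rewrite sumr_const card_rowF mulr1 -natrX.
have /existsP[i ki] : [exists i, k ord0 i != 0].
  rewrite -negb_forall; apply: contra k0 => /forallP k0.
  by apply/eqP/rowP => i; rewrite mxE; apply/eqP.
rewrite mulr0; set S := \sum_x _.
have : S = omg (k ord0 i) * S.
  rewrite {1}/S (reindex_inj (addrI (delta_mx ord0 i))) mulr_sumr /=.
  by apply: eq_bigr => x _; rewrite dotDr dot_delta omega_powD.
move/eqP; rewrite -subr_eq0 -{1}[S]mul1r -mulrBl mulf_eq0 => /orP[|/eqP//].
by rewrite subr_eq0 eq_sym -[X in _ == X](omega_pow0 R d)
  (inj_eq (@omega_pow_inj R d d_prime d_odd)) (negPf ki).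
Qed.

Lemma entry_shiftX k (a b : 'F_d) :
  entry (shiftX R d ^+ k) a b = (a == b + k%:R)%:R.
Proof.
elim: k a b => [|k IHk] a b; first by rewrite expr0 entry1 addr0.
rewrite exprS entry_mul (bigD1 (b + k%:R)) //= big1 => [|c cb].
  by rewrite IHk entry_mkop eqxx mulr1 addr0 -addrA natr1.
by rewrite IHk (negPf cb) mulr0.
Qed.

Lemma entry_clockZ k (a b : 'F_d) :
  entry (clockZ R d ^+ k) a b = (a == b)%:R * omg (k%:R * b).
Proof.
elim: k a b => [|k IHk] a b; first by rewrite expr0 entry1 mul0r mulr1.
rewrite exprS entry_mul (bigD1 b) //= big1 => [|c cb].
  rewrite IHk entry_mkop eqxx mul1r addr0 -mulrA -omega_powD.
  by rewrite mulrS mulrDl mul1r.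
by rewrite IHk (negPf cb) mul0r mulr0.
Qed.

Lemma entry_weylX (q a b : 'rV['F_d]_n) : entry (weylX R q) a b = (a == b + q)%:R.
Proof.
rewrite entry_tensor -prod_eq_row; apply: eq_bigr => k _.
by rewrite entry_shiftX natr_Zp mxE.
Qed.

Lemma entry_weylZ (p a b : 'rV['F_d]_n) :
  entry (weylZ R p) a b = (a == b)%:R * omg (dot p b).
Proof.
rewrite entry_tensor -prod_eq_row omega_pow_sum // -big_split; apply: eq_bigr => k _.
by rewrite entry_clockZ natr_Zp.
Qed.

Lemma entry_weyl (u : V) a b :
  entry (weyl R u) a b = (a == b + u.2)%:R * omg (dot u.1 a - 2%:R^-1 * dot u.1 u.2).
Proof.
rewrite entryZ entry_mul (bigD1 a) //= big1 ?addr0 => [|c ca].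
  rewrite entry_weylZ entry_weylX eqxx mul1r mulrA -omega_powD [LHS]mulrC.
  by congr (_ * omg _); rewrite addrC.
by rewrite entry_weylZ eq_sym (negPf ca) !mul0r.
Qed.

Lemma double_half (x : 'F_d) : 2%:R^-1 * x + 2%:R^-1 * x = x.
Proof.
rewrite -mulrDr -[x + x]mulr2n -[x *+ 2]mulr_natl mulKf //.
rewrite -(dvdn_pcharf (pchar_Fp d_prime)) dvdn_prime2 //.
by apply: contraTN d_odd => /eqP ->.
Qed.

(** Composing the shifts produces a phase that, when the symplectic form vanishes, is exactly
    absorbed by the half-phases in [weyl]. *)
Lemma weylD (u v : V) : symp u v = 0 -> weyl R u *m weyl R v = weyl R (u + v).
Proof.
case: u v => [p q] [p' q']; rewrite /symp /= => /eqP; rewrite subr_eq0 => /eqP uv.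
apply: eq_op => a b; rewrite entry_mul (bigD1 (b + q')) //= big1 ?addr0; last first.
  by move=> c cb; rewrite [X in _ * X]entry_weyl /= (negPf cb) mul0r mulr0.
rewrite !entry_weyl /= eqxx mul1r.
have -> : b + q' + q = b + (q + q') by rewrite -addrA [q' + q]addrC.
have [->|_] := eqVneq a (b + (q + q')); last by rewrite !mul0r.
rewrite !mul1r -omega_powD; congr (omg _).
rewrite !(dotDl, dotDr) uv.
set h := 2%:R^-1.
apply/eqP; rewrite -subr_eq0; apply/eqP.
(* [ring] does not know that [h + h = 1]; this enters by writing the zero on the right as
   [h * x + h * x - x] with [x = dot p' q]. *)
by rewrite -(subrr (dot p' q)) -[X in _ = X - _]double_half -/h; ring.
Qed.

Lemma weyl0 : weyl R (0 : V) = 1%:M.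
Proof.
apply: eq_op => a b; rewrite entry_weyl entry1 /= addr0 !dot0l mulr0 subr0.
by rewrite mulr1.
Qed.

Lemma weyl_adj (u : V) : (weyl R u)^t* = weyl R (- u).
Proof.
apply: eq_op => a b; rewrite entry_adj !entry_weyl /=.
have -> : (a == b - u.2) = (b == a + u.2) by rewrite eq_sym subr_eq.
have [->|_] := eqVneq b (a + u.2); last by rewrite !mul0r rmorph0.
rewrite !mul1r -omega_powN; congr (omg _).
rewrite !(dotDr, dotNl, dotNr); set h := 2%:R^-1.
apply/eqP; rewrite -subr_eq0; apply/eqP.
by rewrite -(subrr (dot u.1 u.2)) -[X in _ = X - _]double_half -/h; ring.
Qed.

(** The diagonal vanishes unless the shift [q] is zero; what remains is a character in [p], summed
    by [char_sum]. *)
Lemma trace_weyl (u : V) : \tr (weyl R u) = d%:R ^+ n * (u == 0)%:R.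
Proof.
rewrite trace_entry; case: u => p q.
under eq_bigr => a _ do rewrite entry_weyl /= -[X in X == _]addr0 (inj_eq (addrI a)) omega_powD mulrA.
rewrite -mulr_suml -mulr_sumr char_sum.
have -> : ((p, q) == 0 :> V) = (p == 0) && (q == 0).
  by rewrite -[0 in LHS]/(0, 0) xpair_eqE.
have [->|q0] := eqVneq q 0; last by rewrite andbF !mulr0 !mul0r.
rewrite mul1r andbT [dot p 0]dotC dot0l mulr0 oppr0 omega_pow0 mulr1.
by [].
Qed.

(** Unlike [stab_proj], this takes a parametrization [beta] instead of a subspace. Characters are
    then row vectors, and maps of phase space act by composition with [beta]. *)
Definition stab (beta : 'rV['F_d]_n -> V) (k : 'rV['F_d]_n) : op R 'rV['F_d]_n :=
  (d%:R ^+ n)^-1 *: \sum_x omg (dot k x) *: weyl R (beta x).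

Lemma dn_neq0 : d%:R ^+ n != 0 :> C.
Proof. by rewrite expf_neq0 // pnatr_eq0 -lt0n prime_gt0. Qed.

Section Stabilizer.
Variable beta : 'rV['F_d]_n -> V.
Hypotheses (betaD : forall x y, beta (x + y) = beta x + beta y)
  (beta_inj : injective beta)
  (beta_iso : forall x y, symp (beta x) (beta y) = 0).

Let beta0 : beta 0 = 0.
Proof. by apply: (addrI (beta 0)); rewrite -betaD !addr0. Qed.

(** After replacing [y] by [y - x], the product of Weyl operators depends on [y] alone, and [x]
    survives only in a character sum for [j - k]. *)
Lemma stab_mul j k : stab beta j *m stab beta k = (j == k)%:R *: stab beta k.
Proof.
rewrite /stab -scalemxAl -scalemxAr scalerA scalerA.
rewrite mulmx_suml.
under eq_bigr => x _.
  rewrite mulmx_sumr (reindex_inj (addIr (- x))) /=.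
  under eq_bigr => y _ do
    rewrite -scalemxAl -scalemxAr weylD // -betaD [x + _]addrC subrK scalerA -omega_powD.
  over.
rewrite exchange_big /= scaler_sumr [RHS]scaler_sumr; apply: eq_bigr => y _.
rewrite -scaler_suml scalerA.
have -> : \sum_x omg (dot j x + dot k (y - x)) = omg (dot k y) * (d%:R ^+ n * (j == k)%:R).
  rewrite -subr_eq0 -char_sum mulr_sumr; apply: eq_bigr => x _.
  by rewrite -omega_powD dotDr !(dotNr, dotDl, dotNl) addrCA.
rewrite scalerA; congr (_ *: _).
rewrite [X in _ * X]mulrCA [omg _ * _]mulrC !mulrA mulfVK ?dn_neq0 //.
by rewrite [_ * (j == k)%:R]mulrC.
Qed.

Lemma stab_adj k : (stab beta k)^t* = stab beta k.
Proof.
apply: eq_op => a b; rewrite entry_adj /stab !entryZ !entry_sum rmorphM rmorph_sum.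
congr (_ * _); first by rewrite fmorphV rmorphXn rmorph_nat.
rewrite [RHS](reindex_inj oppr_inj) /=; apply: eq_bigr => x _.
transitivity (omg (dot k x) * entry (weyl R (beta x)) b a)^*.
  by congr (_^*); apply: entryZ.
transitivity (omg (dot k (- x)) * entry (weyl R (beta (- x))) a b); last first.
  exact/esym/entryZ.
rewrite rmorphM /= -omega_powN -dotNr -(entry_adj (weyl R (beta x))) weyl_adj.
suff -> : beta (- x) = - beta x by [].
by apply: (addIr (beta x)); rewrite -betaD !addNr beta0.
Qed.

Lemma stab_trace k : \tr (stab beta k) = 1.
Proof.
rewrite mxtraceZ trace_sum (bigD1 0) //= big1 ?addr0 => [|x x0].
  by rewrite mxtraceZ beta0 trace_weyl eqxx mulr1 dotC dot0l mul1r mulVf ?dn_neq0.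
by rewrite mxtraceZ trace_weyl -beta0 (inj_eq beta_inj) (negPf x0) !mulr0.
Qed.

Lemma stab_sum : \sum_k stab beta k = 1%:M.
Proof.
rewrite /stab -scaler_sumr exchange_big /=.
have E x : \sum_k omg (dot k x) *: weyl R (beta x) =
    (d%:R ^+ n * (x == 0)%:R) *: weyl R (beta x).
  rewrite -scaler_suml -char_sum; congr (_ *: _).
  by apply: eq_bigr => k _; rewrite dotC.
rewrite (eq_bigr _ (fun x _ => E x)) (bigD1 0) //= big1 ?addr0 => [|x x0].
  by rewrite beta0 weyl0 eqxx mulr1 scalerA mulVf ?dn_neq0 // scale1r.
by rewrite (negPf x0) mulr0 scale0r.
Qed.

Lemma psd_stab k : psd (stab beta k).
Proof.
have := psd_conj (stab beta k) (@psd1 R 'rV['F_d]_n).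
by rewrite mulmx1 stab_adj stab_mul eqxx scale1r.
Qed.

Lemma density_stab k : density (stab beta k).
Proof. by apply/densityE; rewrite stab_trace; split=> //; apply: psd_stab. Qed.

(** By cyclicity and idempotence this is the trace of [A] compressed by the projector. *)
Lemma trace_psd_stab A k : psd A -> 0 <= \tr (A *m stab beta k).
Proof.
move=> /(psd_conj (stab beta k))/trace_psd_ge0.
by rewrite stab_adj mxtrace_mulC mulmxA stab_mul eqxx scale1r mxtrace_mulC.
Qed.

Lemma pinch_le A : psd A ->
  entropy A <= entropy (\sum_k stab beta k *m A *m stab beta k).
Proof.
apply: (entropy_le_unital (Phi := fun A => \sum_k stab beta k *m A *m stab beta k)).
- move=> z B; under [RHS]eq_bigr => i _ do rewrite scaler_sumr.
  rewrite [RHS]exchange_big; apply: eq_bigr => k _.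
  rewrite mulmx_sumr mulmx_suml; apply: eq_bigr => i _.
  by rewrite scalemxAl scalemxAr.
- move=> B B0; under eq_bigr => k _ do rewrite -[_ *m _ *m _]scale1r -{2}stab_adj.
  by apply: psd_sum => k; [exact: ler01|exact: psd_conj].
- move=> B; rewrite trace_sum.
  under eq_bigr => k _ do rewrite mxtrace_mulC mulmxA stab_mul eqxx scale1r.
  by rewrite -trace_sum -mulmx_suml stab_sum mul1mx.
rewrite -[RHS]stab_sum; apply: eq_bigr => k _.
by rewrite mulmx1 stab_mul eqxx scale1r.
Qed.

Lemma pinch_diag (lam : 'rV['F_d]_n -> C) :
  let A := \sum_j lam j *: stab beta j in
  \sum_k stab beta k *m A *m stab beta k = A.
Proof.
move=> A; apply: eq_bigr => k _; rewrite /A mulmx_sumr (bigD1 k) //= big1 ?addr0.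
  by rewrite -(scalemxAr (lam k)) -(scalemxAl (lam k)) !(stab_mul, eqxx, scale1r).
by move=> j jk; rewrite -(scalemxAr (lam j)) stab_mul eq_sym (negPf jk) scale0r scaler0.
Qed.

End Stabilizer.

(** The comparison map [Phi] measures in the basis of [beta], shifted by [s], and prepares the
    matching projector of [gamma]. It is positive, trace preserving and unital, and carries one
    diagonal operator to the other, so no unitary between the two bases has to be built. *)
Lemma entropy_diag_le (beta gamma : 'rV['F_d]_n -> V) (lam : 'rV['F_d]_n -> C) s :
  (forall x y, beta (x + y) = beta x + beta y) -> injective beta ->
  (forall x y, symp (beta x) (beta y) = 0) ->
  (forall x y, gamma (x + y) = gamma x + gamma y) -> injective gamma ->
  (forall x y, symp (gamma x) (gamma y) = 0) ->
  psd (\sum_j lam j *: stab beta (j + s)) ->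
  entropy (\sum_j lam j *: stab beta (j + s)) <= entropy (\sum_j lam j *: stab gamma j).
Proof.
move=> bD bI b0 gD gI g0 A0; pose A := \sum_j lam j *: stab beta (j + s).
pose Phi (B : op R 'rV['F_d]_n) := \sum_j \tr (B *m stab beta (j + s)) *: stab gamma j.
have le_Phi : entropy A <= entropy (Phi A).
  apply: (entropy_le_unital (Phi := Phi)).
  - move=> z B; rewrite /Phi; under [RHS]eq_bigr => i _ do rewrite scaler_sumr.
    rewrite [RHS]exchange_big; apply: eq_bigr => k _.
    rewrite mulmx_suml trace_sum scaler_suml; apply: eq_bigr => i _.
    by rewrite -(scalemxAl (z i)) mxtraceZ -scalerA.
  - move=> B B0; apply: psd_sum => k; last exact: psd_stab.
    exact: trace_psd_stab.
  - move=> B; rewrite /Phi trace_sum.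
    under eq_bigr => k _ do rewrite mxtraceZ stab_trace // mulr1.
    rewrite -trace_sum -mulmx_sumr.
    by rewrite -[RHS](congr1 mxtrace (mulmx1 B)) -(stab_sum bD) [in RHS](reindex_inj (addIr s)).
  - rewrite -[RHS](stab_sum gD); apply: eq_bigr => k _.
    by rewrite mul1mx stab_trace // scale1r.
  - exact: A0.
suff E : Phi A = \sum_j lam j *: stab gamma j.
  exact: (eq_ind _ (fun B => entropy A <= entropy B) le_Phi _ E).
apply: eq_bigr => k _; congr (_ *: _).
rewrite /A mulmx_suml trace_sum (bigD1 k) //= big1 ?addr0 => [|j jk].
  by rewrite -(scalemxAl (lam k)) stab_mul // eqxx scale1r mxtraceZ stab_trace // mulr1.
by rewrite -(scalemxAl (lam j)) stab_mul // (inj_eq (addIr s)) (negPf jk) scale0r scaler0 mxtrace0.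
Qed.

End Weyl.

(** * The convolutional channel *)

Lemma det_mx22 (S : comNzRingType) (A : 'M[S]_2) :
  \det A = A 0 0 * A 1 1 - A 0 1 * A 1 0.
Proof.
have o1 : lift ord0 ord0 = 1 :> 'I_2 by apply: val_inj.
have o0 : lift (lift ord0 ord0) ord0 = 0 :> 'I_2 by apply: val_inj.
rewrite (expand_det_row _ ord0) !big_ord_recl big_ord0 /cofactor !det_mx11 !mxE.
by rewrite /= o0 o1 addr0 expr0 mul1r expr1 mulN1r mulrN.
Qed.

Section Convolution.
Variables (R : realType) (d n : nat) (G : 'M['F_d]_2).
Hypotheses (d_prime : prime d) (d_odd : odd d) (G_pos : positive_convolution G).
Local Notation C := R[i].
Local Notation "'omg' x" := (@omega_pow R d x) (at level 10, x at level 8).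
Local Notation V := ('rV['F_d]_n * 'rV['F_d]_n)%type.
Local Notation omega_powD := (omega_powD R d_prime d_odd).

(** The inverse of [conv_map]: the transpose of [G] acting on the pair. *)
Definition conv_pre (x : V) : V :=
  (G 0 0 *: x.1 + G 1 0 *: x.2, G 0 1 *: x.1 + G 1 1 *: x.2).

Let N := (\det G)^-1.

Lemma conv_det : N * (G 0 0 * G 1 1 - G 0 1 * G 1 0) = 1.
Proof.
have [] := G_pos; rewrite unitmxE unitfE => detG _.
rewrite -(det_mx22 G) mulVf //.
Qed.

Lemma conv_mapK : cancel (@conv_map d n G) conv_pre.
Proof.
case=> x y; congr pair; apply/rowP => k; rewrite !mxE /= -/N.
  transitivity (N * (G 0 0 * G 1 1 - G 0 1 * G 1 0) * x ord0 k); first by ring.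
  by rewrite conv_det mul1r.
transitivity (N * (G 0 0 * G 1 1 - G 0 1 * G 1 0) * y ord0 k); first by ring.
by rewrite conv_det mul1r.
Qed.

Lemma conv_preK : cancel conv_pre (@conv_map d n G).
Proof.
case=> x y; congr pair; apply/rowP => k; rewrite !mxE /= -/N.
  transitivity (N * (G 0 0 * G 1 1 - G 0 1 * G 1 0) * x ord0 k); first by ring.
  by rewrite conv_det mul1r.
transitivity (N * (G 0 0 * G 1 1 - G 0 1 * G 1 0) * y ord0 k); first by ring.
by rewrite conv_det mul1r.
Qed.

Lemma conv_pre_bij : bijective conv_pre.
Proof. by exists (@conv_map d n G); [apply: conv_preK|apply: conv_mapK]. Qed.

Lemma conv_pre_inj1 a : injective (fun j => (conv_pre (a, j)).1).
Proof. by move=> x y /= /addrI /(scalerI (G_pos.2 _ _)). Qed.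

Lemma conv_pre_inj2 j : injective (fun a => (conv_pre (a, j)).2).
Proof. by move=> x y /= /addIr /(scalerI (G_pos.2 _ _)). Qed.

(** [conv_unitary] is a permutation matrix, so each of the two matrix products keeps a single
    term. *)
Lemma conv_channel_twist (sigma : op R 'rV['F_d]_n) :
  conv_channel G sigma = twist conv_pre sigma.
Proof.
apply/funext => rho; apply: eq_op => a b; rewrite !entry_mkop.
have U x y : entry (conv_unitary R n G) x y = (conv_pre x == y)%:R.
  by rewrite entry_mkop (can2_eq conv_preK conv_mapK).
apply: eq_bigr => j _; rewrite entry_mul (bigD1 (conv_pre (b, j))) //= big1 ?addr0.
  rewrite entry_adj U eqxx rmorph1 mulr1 entry_mul (bigD1 (conv_pre (a, j))) //= big1 ?addr0.
    by rewrite U eqxx mul1r entry_mkop.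
  by move=> y ya; rewrite U eq_sym (negPf ya) mul0r.
by move=> y yb; rewrite entry_adj U eq_sym (negPf yb) rmorph0 mulr0.
Qed.

(* The maps A and B of the header: w(z) is produced from w(phase_rho z) and
   w(phase_sigma z). *)
Definition phase_rho (z : V) : V := ((N * G 1 1) *: z.1, G 0 0 *: z.2).
Definition phase_sigma (z : V) : V := (- (N * G 1 0) *: z.1, G 0 1 *: z.2).

Lemma twist_weyl (y z : V) :
  twist conv_pre (weyl R (phase_sigma y)) (weyl R (phase_rho z)) =
  (d%:R ^+ n * (y == z)%:R) *: weyl R z.
Proof.
have [G00 G01 G10 G11] : [/\ G 0 0 != 0, G 0 1 != 0, G 1 0 != 0 & G 1 1 != 0].
  by split; apply: G_pos.2.
apply: eq_op => a b; rewrite entry_mkop entryZ entry_weyl //.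
case: y z => [p' q'] [p q] /=.
have shift (s t : 'F_d) (j r : 'rV['F_d]_n) : s != 0 ->
    (s *: a + t *: j == s *: b + t *: j + s *: r) = (a == b + r).
  move=> s0; rewrite addrAC (inj_eq (addIr _)) -scalerDr.
  by rewrite (inj_eq (scalerI s0)).
pose h : 'F_d := 2%:R^-1.
(* The shifts contribute the two equalities of indices; the phase is split into a part free of [j]
   and a character of [j] with frequency proportional to [p - p']. *)
have E j : entry (weyl R (phase_rho (p, q))) (conv_pre (a, j)).1 (conv_pre (b, j)).1 *
    entry (weyl R (phase_sigma (p', q'))) (conv_pre (a, j)).2 (conv_pre (b, j)).2 =
    (a == b + q)%:R * (a == b + q')%:R *
    (omg (N * G 1 1 * G 0 0 * dot p a - h * (N * G 1 1 * G 0 0 * dot p q)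
         - N * G 1 0 * G 0 1 * dot p' a + h * (N * G 1 0 * G 0 1 * dot p' q')) *
     omg (dot ((N * G 1 1 * G 1 0) *: (p - p')) j)).
  rewrite !(entry_weyl R d_prime d_odd) /= !shift // mulrACA -!omega_powD.
  congr (_ * omg _).
  by rewrite !(dotDl, dotDr, dotZl, dotZr, dotNl, dotNr) -/h; ring.
rewrite (eq_bigr _ (fun j _ => E j)) -!mulr_sumr char_sum //.
rewrite scaler_eq0 !mulf_eq0 (negPf G11) (negPf G10) !orbF subr_eq0 xpair_eqE.
have N0 : N == 0 = false.
  by apply/negP => /eqP N0; have /eqP := conv_det; rewrite N0 mul0r eq_sym oner_eq0.
rewrite N0 /= [p == p']eq_sym.
have [ab|] := eqVneq a (b + q); last by rewrite !mul0r mulr0.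
rewrite {1}ab (inj_eq (addrI b)) [q == q']eq_sym.
have [->|] := eqVneq q' q; last by rewrite andbF !(mulr0, mul0r).
rewrite andbT; have [->|_] := eqVneq p' p; last by rewrite !(mulr0, mul0r).
rewrite !mul1r !mulr1 mulrC; congr (_ * omg _).
(* With both labels equal, the phases combine with coefficient [N] times the determinant, which is
   1. *)
rewrite -/h -[RHS]mul1r -conv_det; ring.
Qed.

(** In the bilinear expansion [twist_weyl] keeps only equal labels. There the characters multiply to
    that of [j + k], and the factor [d%:R ^+ n] cancels one of the two normalizations. *)
Lemma twist_stab (beta : 'rV['F_d]_n -> V) j k : injective beta ->
  twist conv_pre (stab R (phase_sigma \o beta) j) (stab R (phase_rho \o beta) k) =
  stab R beta (j + k).
Proof.
move=> beta_inj; have dn0 := dn_neq0 R n d_prime.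
have stabE (b : 'rV['F_d]_n -> V) l :
    stab R b l = \sum_x ((d%:R ^+ n)^-1 * omg (dot l x)) *: weyl R (b x).
  by rewrite /stab scaler_sumr; apply: eq_bigr => x _; apply: scalerA.
rewrite !stabE twist_suml; apply: eq_bigr => x _.
rewrite twist_sumr (bigD1 x) //= big1 ?addr0 => [|y yx]; last first.
  by rewrite twist_weyl (inj_eq beta_inj) eq_sym (negPf yx) mulr0 scale0r scaler0.
rewrite twist_weyl eqxx mulr1 !scalerA; congr (_ *: _).
rewrite dotDl omega_powD.
move: (omg _) (omg _) (mulVf dn0); set u := d%:R ^+ n; move: u u^-1 => u v s t vu.
by rewrite -[RHS]mulr1 -vu; ring.
Qed.

End Convolution.

(** * Characters of a maximal isotropic subspace *)

Section Dual.
Variables (R : realType) (d n : nat) (M : {vspace phase_space d n})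
  (X : n.-tuple (phase_space d n)).
Hypotheses (d_prime : prime d) (d_odd : odd d) (X_basis : basis_of M X).
Local Notation C := R[i].
Local Notation "'omg' x" := (@omega_pow R d x) (at level 10, x at level 8).
Local Notation V := ('rV['F_d]_n * 'rV['F_d]_n)%type.

Definition lincomb (x : 'rV['F_d]_n) : phase_space d n := \sum_i x ord0 i *: X`_i.

Definition coords (u : phase_space d n) : 'rV['F_d]_n := \row_i coord X i u.

Lemma lincombD x y : lincomb (x + y) = lincomb x + lincomb y.
Proof. by rewrite -big_split; apply: eq_bigr => i _; rewrite mxE scalerDl. Qed.

Lemma lincombK : cancel lincomb coords.
Proof.
move=> x; apply/rowP => i; rewrite mxE coord_sum_free //.
exact: basis_free X_basis.
Qed.

Lemma coordsK u : u \in M -> lincomb (coords u) = u.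
Proof.
move=> uM; rewrite [RHS](coord_basis X_basis uM).
by apply: eq_bigr => i _; rewrite mxE.
Qed.

Lemma lincomb_mem x : lincomb x \in M.
Proof.
apply: memv_suml => i _; apply: memvZ; apply: (basis_mem X_basis).
by rewrite mem_nth // size_tuple.
Qed.

Lemma coordsD u v : coords (u + v) = coords u + coords v.
Proof. by apply/rowP => i; rewrite !mxE linearD. Qed.

Definition chi (k : 'rV['F_d]_n) (u : subvs_of M) : C := omg (dot k (coords (vsval u))).

Lemma chi_lincomb k x : chi k (vsproj M (lincomb x)) = omg (dot k x).
Proof. by rewrite /chi vsprojK ?lincomb_mem // lincombK. Qed.

Lemma chi_dual k : dual R M (chi k).
Proof.
split=> [u|u v].
  apply/eqP; rewrite -(@pexpr_eq1 _ _ 2) // normCK; apply/eqP.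
  exact: omega_pow_norm.
by rewrite /chi linearD coordsD dotDr omega_powD.
Qed.

Lemma chi_inj : injective chi.
Proof.
move=> k l kl; apply/rowP => i; rewrite -!dot_delta.
apply: (@omega_pow_inj R d d_prime d_odd).
by rewrite -!chi_lincomb kl.
Qed.

(** On each basis vector [mu] is a [d]-th root of unity, because [d] annihilates phase space. It is
    therefore a power of [omega], and the exponents form the vector [k]. *)
Lemma dual_chi mu : dual R M mu -> exists k, chi k = mu.
Proof.
move=> [mu1 muD].
have mu0 : mu 0 = 1.
  have : mu 0 != 0 by rewrite -normr_eq0 mu1 oner_eq0.
  by move=> mu00; apply: (mulfI mu00); rewrite -muD addr0 mulr1.
have muX u k : mu (u *+ k) = mu u ^+ k.
  by elim: k => [|k IHk]; rewrite ?mulr0n // mulrS muD IHk exprS.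
have /choice[f fP] : forall i : 'I_n, exists k : 'F_d, mu (vsproj M X`_i) = omg k.
  move=> i; have : mu (vsproj M X`_i) ^+ d = 1.
    rewrite -muX -[_ *+ d]scaler_nat (_ : d%:R = 0 :> 'F_d) ?scale0r //.
    by have := pchar_Fp d_prime; rewrite inE => /andP[_ /eqP].
  move=> /(prim_rootP (omega_prim R d_prime d_odd))[k ->].
  by exists (k : nat)%:R; rewrite omega_pow_nat.
exists (\row_i f i); apply/funext => u.
have {2}-> : u = \sum_i (coords (vsval u)) ord0 i *: vsproj M X`_i.
  apply: val_inj; rewrite linear_sum /= -{1}(coordsK (subvsP u)).
  apply: eq_bigr => i _; rewrite ?linearZ /= vsprojK //.
  by apply: (basis_mem X_basis); rewrite mem_nth // size_tuple.
rewrite (big_morph mu muD mu0) /chi /dot omega_pow_sum //.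
apply: eq_bigr => i _; rewrite mxE.
set c := coords _ _ _; rewrite -[c in RHS]natr_Zp scaler_nat muX fP.
by rewrite omega_powX // natr_Zp.
Qed.

(** [chi] is a bijection from row vectors onto the dual, which turns the finitely supported sum into
    an ordinary one. *)
Lemma sum_dual (W : nmodType) (F : (subvs_of M -> C) -> W) :
  \sum_(mu \in dual R M) F mu = \sum_k F (chi k).
Proof.
rewrite (@reindex_fsbig _ _ _ _ _ chi setT).
  have -> : [set: 'rV['F_d]_n] = [set` index_enum {: 'rV['F_d]_n}].
    by apply/seteqP; split=> k //= _; rewrite mem_index_enum.
  by rewrite -fsbig_seq // index_enum_uniq.
split=> [k _|k l _ _ /chi_inj //|mu /dual_chi[k <-]]; first exact: chi_dual.
by exists k.
Qed.

Lemma stab_proj_chi k : stab_proj (chi k) = stab R lincomb k.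
Proof.
congr (_ *: _); rewrite (reindex_onto lincomb coords) /=; last by move=> u /coordsK.
apply: eq_big => [x|x _]; first by rewrite lincomb_mem lincombK eqxx.
by rewrite chi_lincomb.
Qed.

Lemma stab_diag_dual (lam : (subvs_of M -> C) -> C) :
  \sum_(mu \in dual R M) lam mu *: stab_proj mu = \sum_k lam (chi k) *: stab R lincomb k.
Proof. by rewrite sum_dual; apply: eq_bigr => k _; rewrite stab_proj_chi. Qed.

Lemma pinching_stab (A : op R 'rV['F_d]_n) :
  pinching M A = \sum_k stab R lincomb k *m A *m stab R lincomb k.
Proof. by rewrite /pinching sum_dual; apply: eq_bigr => k _; rewrite stab_proj_chi. Qed.

End Dual.

Lemma max_isotropic_basis d n (M : {vspace phase_space d n}) : max_isotropic M ->
  exists X : n.-tuple (phase_space d n), basis_of M X.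
Proof. by case=> _ dimM; exists (tcast dimM (vbasis M)); rewrite val_tcast vbasisP. Qed.

(** * Capacity *)

Section Capacity.
Variables (R : realType) (I : finType) (c : I * I -> I * I).
Variables (sigma : op R I) (K : finType) (rho : K -> op R I).
Hypotheses (c_bij : bijective c)
  (c_inj1 : forall a, injective (fun j => (c (a, j)).1))
  (c_inj2 : forall j, injective (fun a => (c (a, j)).2))
  (sigma_state : density sigma)
  (K_gt0 : (0 < #|K|)%N) (rho_state : forall k, density (rho k))
  (rho_mix : \sum_k (#|K|%:R^-1)%:C%C *: twist c sigma (rho k) = #|I|%:R^-1 *: 1%:M)
  (rho_entropy : forall k, entropy (twist c sigma (rho k)) <= entropy sigma).

Lemma twist_holevo :
  let L := twist c sigma in let x := log2 #|I|%:R - entropy sigma in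
  holevo_values L x /\ ubound (holevo_values L) x.
Proof.
move=> L x; apply: (@holevo_max _ _ _ _ L _ rho).
- by move=> r; apply: density_twist.
- by move=> r; apply: entropy_le_twist.
- exact: K_gt0.
- exact: rho_state.
- by rewrite /L twist_sumr.
- exact: rho_entropy.
Qed.

Lemma log2X (a m : nat) : log2 (a ^ m)%N%:R = m%:R * log2 a%:R :> R.
Proof.
(* For [a = 0] both sides vanish, through [0 ^ 0 = 1] when [m = 0] and [ln 0 = 0] otherwise. *)
have [->|a0] := posnP a.
  case: m => [|m]; first by rewrite mul0r expn0 /log2 ln1 mul0r.
  by rewrite exp0n // /log2 ln0 // mul0r mulr0.
elim: m => [|m IHm]; first by rewrite expn0 mul0r /log2 ln1 mul0r.
rewrite expnS natrM /log2 lnM ?posrE ?ltr0n ?expn_gt0 ?a0 // mulrDl.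
by rewrite -!/(log2 _) IHm -natr1 mulrDl mul1r addrC.
Qed.

(** The power channel is a twist by [row_pair c], so [holevo_max] applies again, with product inputs
    indexed by ['rV[K]_m]. Their average output is the tensor power of the one-copy average, and
    entropies add. *)
Lemma power_holevo m :
  let L := channel_power (twist c sigma) (m:=m) in
  let x := m%:R * (log2 #|I|%:R - entropy sigma) in
  holevo_values L x /\ ubound (holevo_values L) x.
Proof.
have S_tensor : entropy (tensor_family (fun _ : 'I_m => sigma)) = m%:R * entropy sigma.
  by rewrite entropy_tensor // sumr_const card_ord mulr_natl.
have -> : channel_power (twist c sigma) (m:=m) =
    twist (row_pair c (m:=m)) (tensor_family (fun=> sigma)).
  by apply/funext => r; apply: channel_power_twist.
have -> : m%:R * (log2 #|I|%:R - entropy sigma) =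
    log2 #|{: 'rV[I]_m}|%:R - entropy (tensor_family (fun _ : 'I_m => sigma)).
  by rewrite card_mx mul1n log2X S_tensor mulrBr.
have tensor_state (A : 'I_m -> op R I) : (forall k, density (A k)) ->
  density (tensor_family A) by apply: density_tensor.
have c_bij' := row_pair_bij m c_bij.
apply: (@holevo_max _ _ _ 'rV[K]_m _ _ (fun x => tensor_family (fun k => rho (x ord0 k)))).
- by move=> r; apply: density_twist => //; apply: tensor_state.
- move=> r; apply: entropy_le_twist => //; last exact: tensor_state.
    by move=> a; apply: row_pair_inj1.
  by move=> a; apply: row_pair_inj2.
- by rewrite card_mx expn_gt0 K_gt0.
- by move=> x; apply: tensor_state.
- have : tensor_family (fun _ : 'I_m =>
      \sum_k (#|K|%:R^-1)%:C%C *: twist c sigma (rho k)) = #|{: 'rV[I]_m}|%:R^-1 *: 1%:M.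
    rewrite rho_mix tensorZ tensor1 prodr_const card_ord card_mx mul1n.
    by rewrite natrX exprVn.
  rewrite tensor_sum twist_sumr => <-; apply: eq_bigr => x _.
  rewrite twist_tensor tensorZ prodr_const card_ord; congr (_ *: _).
  by rewrite card_mx mul1n natrX -exprVn rmorphXn.
move=> x; rewrite twist_tensor (entropy_tensor (fun=> sigma_state)).
rewrite (entropy_tensor (A := fun k => twist c sigma (rho (x ord0 k)))).
  by apply: ler_sum => k _; apply: rho_entropy.
by move=> k; apply: density_twist.
Qed.

End Capacity.

Section HolevoSup.
Variable R : realType.

Lemma sup_max (A : set R) x : A x -> ubound A x -> sup A = x.
Proof.
move=> Ax ubx; apply: le_anti; rewrite ge_sup //=; last by exists x.
by apply: ub_le_sup => //; exists x.
Qed.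

Lemma inf_min (A : set R) x : A x -> lbound A x -> inf A = x.
Proof.
move=> Ax lbx; apply: le_anti; rewrite lb_le_inf //=; last by exists x.
by rewrite andbT; apply: ge_inf => //; exists x.
Qed.

End HolevoSup.

(** * Pinching minimum and optimal ensemble for a stabilizer-diagonal state *)

Section Main.
Variables (R : realType) (d n : nat) (G : 'M['F_d]_2).
Variables (sigma : op R 'rV['F_d]_n) (M0 : {vspace phase_space d n})
    (lambda : (subvs_of M0 -> R[i]) -> R[i]).
Hypotheses (d_prime : prime d) (d_odd : odd d) (G_pos : positive_convolution G)
    (sigma_state : density sigma) (M0_max : max_isotropic M0)
    (sigma_diag : sigma = \sum_(mu \in dual R M0) lambda mu *: stab_proj mu).

Lemma min_pinched :
  pinched_entropies sigma (entropy sigma) /\ lbound (pinched_entropies sigma) (entropy sigma).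
Proof.
split.
  have [X X_basis] := max_isotropic_basis M0_max.
  have iso x y : symp (lincomb X x) (lincomb X y) = 0.
    by apply: M0_max.1; apply: lincomb_mem X_basis _.
  exists M0; first exact: M0_max.
  congr entropy.
  rewrite (pinching_stab d_prime d_odd X_basis) sigma_diag (stab_diag_dual d_prime d_odd X_basis).
  exact: (pinch_diag d_prime d_odd (@lincombD d n X) iso (fun k => lambda (chi R X k))).
move=> _ [M M_max <-].
have [X X_basis] := max_isotropic_basis M_max.
have iso x y : symp (lincomb X x) (lincomb X y) = 0.
  by apply: M_max.1; apply: lincomb_mem X_basis _.
rewrite (pinching_stab d_prime d_odd X_basis).
apply: (pinch_le d_prime d_odd (@lincombD d n X) iso).
by have /densityE[] := sigma_state.
Qed.

(** Such scalings keep isotropic parametrizations isotropic. *)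
Lemma symp_scale (a b : 'F_d) (u v : 'rV['F_d]_n * 'rV['F_d]_n) :
  symp (a *: u.1, b *: u.2) (a *: v.1, b *: v.2) = a * b * symp u v.
Proof. by rewrite /symp /= !(dotZl, dotZr); ring. Qed.

Lemma scale_pair_inj (a b : 'F_d) : a != 0 -> b != 0 ->
  injective (fun u : 'rV['F_d]_n * 'rV['F_d]_n => (a *: u.1, b *: u.2)).
Proof. by move=> a0 b0 [p q] [p' q'] [/(scalerI a0) -> /(scalerI b0) ->]. Qed.

Lemma channel_ensemble : exists rho : 'rV['F_d]_n -> op R 'rV['F_d]_n,
  [/\ forall k, density (rho k),
      \sum_k (#|{: 'rV['F_d]_n}|%:R^-1)%:C%C *: twist (conv_pre G) sigma (rho k) =
        #|{: 'rV['F_d]_n}|%:R^-1 *: 1%:M &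
      forall k, entropy (twist (conv_pre G) sigma (rho k)) <= entropy sigma].
Proof.
have [X X_basis] := max_isotropic_basis M0_max.
pose gamma : 'rV['F_d]_n -> 'rV['F_d]_n * 'rV['F_d]_n := lincomb X.
have gD : forall x y, gamma (x + y) = gamma x + gamma y by apply: lincombD.
have gI : injective gamma := can_inj (lincombK X_basis).
have g0 x y : symp (gamma x) (gamma y) = 0 by apply: M0_max.1; apply: lincomb_mem X_basis _.
have sigmaE : sigma = \sum_j lambda (chi R X j) *: stab R gamma j.
  by rewrite sigma_diag (stab_diag_dual d_prime d_odd X_basis).
set lam := fun j => lambda (chi R X j) in sigmaE.
pose N := (\det G)^-1.
have N0 : N != 0.
  by apply/eqP => N0; have /eqP := conv_det G_pos; rewrite -/N N0 mul0r eq_sym oner_eq0.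
have a0 : - (N * G 1 0) != 0 by rewrite oppr_eq0 mulf_neq0 //; apply: G_pos.2.
have b0 : G 0 1 != 0 by apply: G_pos.2.
(* [beta] is [gamma] composed with the inverse of [phase_sigma G], so that [sigma] is diagonal for
   [phase_sigma G \o beta], as [twist_stab] requires. *)
pose beta x : 'rV['F_d]_n * 'rV['F_d]_n :=
  ((- (N * G 1 0))^-1 *: (gamma x).1, (G 0 1)^-1 *: (gamma x).2).
have betaD x y : beta (x + y) = beta x + beta y.
  by rewrite /beta gD; congr pair; rewrite scalerDr.
have sigma_beta : phase_sigma G \o beta = gamma.
  apply/funext => x; rewrite /phase_sigma /beta /= -/N !scalerA !divff //.
  by rewrite !scale1r; case: (gamma x).
have betaI : injective beta.
  by move=> x y xy; apply: gI; rewrite -sigma_beta /= xy.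
have beta_iso x y : symp (beta x) (beta y) = 0 by rewrite symp_scale g0 mulr0.
pose delta := phase_rho G \o beta.
have deltaD x y : delta (x + y) = delta x + delta y.
  by rewrite /delta /= betaD; congr pair; rewrite scalerDr.
have deltaI : injective delta.
  have NG11 : N * G 1 1 != 0 by rewrite mulf_neq0 //; apply: G_pos.2.
  have G00 : G 0 0 != 0 by apply: G_pos.2.
  exact: inj_comp (scale_pair_inj NG11 G00) betaI.
have delta_iso x y : symp (delta x) (delta y) = 0 by rewrite symp_scale beta_iso mulr0.
(* The input labelled [k] only translates the labels of the spectrum of [sigma]. *)
have outE k : twist (conv_pre G) sigma (stab R delta k) =
    \sum_j lam j *: stab R beta (j + k).
  rewrite sigmaE twist_suml; apply: eq_bigr => j _; congr (_ *: _).
  by rewrite -sigma_beta twist_stab.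
have rho_state k : density (stab R delta k) by apply: density_stab.
exists (stab R delta); split=> [||k]; first exact: rho_state.
  rewrite -scaler_sumr fmorphV rmorph_nat; congr (_ *: _).
  rewrite (eq_bigr _ (fun k _ => outE k)) exchange_big /=.
  (* For each [j] the projectors labelled [j + k] sum over [k] to the identity, so the mixture
     carries the total weight of [lam], the trace of [sigma]. *)
  have lam1 : \sum_j lam j = 1.
    have /densityE[_ <-] := sigma_state; rewrite sigmaE trace_sum.
    by apply: eq_bigr => j _; rewrite mxtraceZ stab_trace // mulr1.
  rewrite -[RHS]scale1r -[X in _ = X *: _]lam1 scaler_suml; apply: eq_bigr => j _.
  rewrite -scaler_sumr -(stab_sum R d_prime d_odd betaD); congr (_ *: _).
  by rewrite [RHS](reindex_inj (addrI j)).
rewrite outE [X in _ <= entropy X]sigmaE.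
(* Reindexing is built into the lemma: the shift [s] is the input label [k]. *)
apply: entropy_diag_le => //.
rewrite -outE; apply: psd_twist; first by have /densityE[] := sigma_state.
by have /densityE[] := rho_state k.
Qed.

End Main.

Theorem theorem12 (R : realType) (d n : nat) (G : 'M['F_d]_2)
    (sigma : op R 'rV['F_d]_n) (M0 : {vspace phase_space d n})
    (lambda : (subvs_of M0 -> R[i]) -> R[i])
    (d_prime : prime d) (d_odd : odd d) (n_ge1 : (1 <= n)%N)
    (G_pos : positive_convolution G)
    (sigma_state : density sigma)
    (M0_max : max_isotropic M0)
    (sigma_diag : sigma = \sum_(mu \in dual R M0) lambda mu *: stab_proj mu) :
  let Lambda := conv_channel G sigma in
  (* the maxima, the limit and the minimum below exist *)
  [/\ has_max (holevo_values Lambda),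
      (forall m, has_max (holevo_values (@channel_power R _ _ Lambda m))),
      cvgn (holevo_rate Lambda) &
      has_min (pinched_entropies sigma)] /\
  [/\ holevo_capacity Lambda = holevo_info Lambda,
      holevo_info Lambda = n%:R * log2 d%:R - entropy sigma &
      n%:R * log2 d%:R - entropy sigma =
        n%:R * log2 d%:R - inf (pinched_entropies sigma)].
Proof.
move=> Lambda; set S := entropy sigma.
have [rho [rho_state rho_mix rho_entropy]] :=
  channel_ensemble d_prime d_odd G_pos sigma_state M0_max sigma_diag.
have LambdaE : Lambda = twist (conv_pre G) sigma by apply: conv_channel_twist.
have c_bij := conv_pre_bij n G_pos.
have c_inj1 (a : 'rV['F_d]_n) := conv_pre_inj1 G_pos (a := a).
have c_inj2 (j : 'rV['F_d]_n) := conv_pre_inj2 G_pos (j := j).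
have K_gt0 : (0 < #|{: 'rV['F_d]_n}|)%N by rewrite card_rowF // expn_gt0 prime_gt0.
have log_card : log2 #|{: 'rV['F_d]_n}|%:R = n%:R * log2 d%:R :> R.
  by rewrite card_rowF // log2X.
have [L1 L2] := twist_holevo c_bij c_inj1 c_inj2 sigma_state K_gt0 rho_state rho_mix rho_entropy.
rewrite -LambdaE log_card -/S in L1 L2.
have Lm m := power_holevo c_bij c_inj1 c_inj2 sigma_state K_gt0 rho_state rho_mix rho_entropy m.
rewrite -LambdaE log_card -/S in Lm.
have [P1 P2] := min_pinched d_prime d_odd sigma_state M0_max sigma_diag.
have infoE : holevo_info Lambda = n%:R * log2 d%:R - S by apply: sup_max.
have rate_cvg : holevo_rate Lambda @ \oo --> n%:R * log2 d%:R - S.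
  (* The rate is constant only from [m = 1] on; at [m = 0] the factor [m%:R^-1] is 0. *)
  apply: (cvg_near_cst); exists 1%N => // m /= m_gt0.
  have [Lm1 Lm2] := Lm m.
  by rewrite /holevo_rate /holevo_info (sup_max Lm1 Lm2) mulKf // pnatr_eq0 -lt0n.
split; split.
- by exists (n%:R * log2 d%:R - S).
- by move=> m; have [Lm1 Lm2] := Lm m; exists (m%:R * (n%:R * log2 d%:R - S)).
- by apply/cvg_ex; exists (n%:R * log2 d%:R - S).
- by exists S.
- by rewrite infoE /holevo_capacity; apply/cvg_lim.
- exact: infoE.
- by rewrite (inf_min P1 P2).
Qed.
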